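(* Let $X$ be a real B-convex Banach space and let $(\Omega,\Sigma,\mu)$ be a probability space. Then for every independent sequence of random sets $\Psi_n:\Omega\to BC(X)$, $n\in\mathbb N$, with mathematical expectations $E(\Psi_n)=\{0\}$ for all $n$ and with uniformly bounded variances, i.e. $\sup_n\int_\Omega\|\Psi_n(\omega)\|^2\,d\mu(\omega)<\infty$, one has $$ \left\|\frac1n\sum_{i=1}^n\Psi_i(\omega)\right\|\xrightarrow[n\to\infty]{}0\quad\text{for almost every }\omega\in\Omega . $$
   Context: A Banach space $X$ is B-convex if there are $n\in\mathbb N$, $n\ge2$, and $\varepsilon>0$ such that for all $x_1,\dots,x_n$ in the unit ball of $X$ there is a choice of signs with $\|\sum_{i=1}^n\pm x_i\|\le(1-\varepsilon)n$. For a nonempty bounded $A\subset X$, $\|A\|=\sup_{a\in A}\|a\|$. Sums of sets are Minkowski sums, $tA=\{ta:a\in A\}$. $\rho_H$ is the Hausdorff distance, $\rho_H(A,B)=\max\{\sup_{b\in B}\inf_{a\in A}\|a-b\|,\ \sup_{a\in A}\inf_{b\in B}\|a-b\|\}$. $BC(X)$ is the set of all nonempty bounded convex subsets of $X$, where sets $A,B$ with $\rho_H(A,B)=0$ (equivalently, with the same closure) are identified; it is a metric space under $\rho_H$, with the operations induced by Minkowski sum and multiplication by positive scalars. $Z(X)$ is the Banach space of bounded continuous real functions on the unit sphere $S_{X^*}$ of the dual, with the sup norm. The Rådström embedding $R:BC(X)\to Z(X)$ is $(R(A))(x^* )=\sup_{a\in A}x^*(a)$; it is isometric and additive, and positively homogeneous.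 A multifunction $F:\Omega\to BC(X)$ is a random set if $(R\circ F)^{-1}(G)\in\Sigma$ for every open $G\subset Z(X)$. It has mathematical expectation $E(F)=A\in BC(X)$ if $R\circ F$ is Bochner integrable with $\int_\Omega R\circ F\,d\mu=R(A)$. Random sets $F_n$ are independent if the random vectors $R\circ F_n$ are independent. *)

(* Defs.v *)
From HB Require Import structures.
From mathcomp Require Import all_boot all_order all_algebra.
From mathcomp Require Import all_classical all_reals all_analysis.

Set Implicit Arguments.
Unset Strict Implicit.
Unset Printing Implicit Defensive.

Import Order.TTheory GRing.Theory Num.Theory.
Import numFieldNormedType.Exports.

Local Open Scope classical_set_scope.
Local Open Scope ring_scope.

Section SupNorm.
Context {R : realType} {T : Type} {V : normedModType R}.
Implicit Types (D : set T) (f g : T -> V).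

(* The intended value when f is bounded on D; it is 0 when D is empty. *)
Definition supnorm D f : R := sup [set `|f x| | x in D].

Lemma supnorm_has_ub D f :
  [bounded f x | x in D] -> has_ubound [set `|f x| | x in D].
Proof.
move=> /ex_strict_bound_gt0[M M0 fM]; exists M => _ /= [x Dx <-].
exact/ltW/fM.
Qed.

Lemma supnorm_ge D f x : [bounded f x | x in D] -> D x -> `|f x| <= supnorm D f.
Proof. by move=> bf Dx; apply: ub_le_sup; [exact: supnorm_has_ub|exists x]. Qed.

Lemma supnorm_le D f (M : R) :
  0 <= M -> (forall x, D x -> `|f x| <= M) -> supnorm D f <= M.
Proof.
move=> M0 fM; have [[x Dx]|D0] := pselect (exists x, D x).
  by apply: ge_sup; [exists `|f x|, x|move=> _ /= [y Dy <-]; exact: fM].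
rewrite /supnorm (_ : [set _ | _ in D] = set0) ?sup0//.
by rewrite -subset0 => _ /= [x Dx _]; apply: D0; exists x.
Qed.

Lemma supnorm_ge0 D f : 0 <= supnorm D f.
Proof.
rewrite /supnorm; set E := (X in sup X).
have [[[y Ey] ubE]|/sup_out->//] := pselect (has_sup E).
apply: (@le_trans _ _ y); last exact: ub_le_sup.
by case: Ey => x _ <-.
Qed.

Lemma le_bounded D f (M : R) :
  (forall x, D x -> `|f x| <= M) -> [bounded f x | x in D].
Proof.
move=> fM; rewrite /bounded_near; near=> N => x /= Dx; by rewrite (le_trans (fM _ Dx)).
Unshelve. all: by end_near. Qed.

Lemma boundedZ D (l : R) f :
  [bounded f x | x in D] -> [bounded (l *: f) x | x in D].
Proof.
move=> /supnorm_has_ub[M fM]; apply: (@le_bounded _ _ (`|l| * M)) => y Dy.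
by rewrite normrZ ler_wpM2l//; apply: fM; exists y.
Qed.

Lemma supnormD D f g : [bounded f x | x in D] -> [bounded g x | x in D] ->
  supnorm D (f + g) <= supnorm D f + supnorm D g.
Proof.
move=> bf bg; apply: supnorm_le => [|x Dx].
  by rewrite addr_ge0// supnorm_ge0.
by rewrite (le_trans (ler_normD _ _))// lerD// supnorm_ge.
Qed.

Lemma supnormZ D (l : R) f : [bounded f x | x in D] ->
  supnorm D (l *: f) = `|l| * supnorm D f.
Proof.
move=> bf; apply/eqP; rewrite eq_le; apply/andP; split.
  apply: supnorm_le => [|x Dx]; first by rewrite mulr_ge0// supnorm_ge0.
  by rewrite normrZ ler_wpM2l// supnorm_ge.
have [->|l0] := eqVneq l 0; first by rewrite normr0 mul0r supnorm_ge0.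
rewrite -ler_pdivlMl ?normr_gt0//; apply: supnorm_le => [|x Dx].
  by rewrite mulr_ge0 ?invr_ge0// supnorm_ge0.
rewrite ler_pdivlMl ?normr_gt0// -normrZ.
by apply: (@supnorm_ge D (l *: f)) => //; exact: boundedZ.
Qed.

End SupNorm.

Section ContinuousDual.
Context {R : realType} {X : normedModType R}.

Definition cdual_pred : {pred X -> R^o} :=
  mem [set f : X -> R^o | linear f /\ continuous f].

Record cdual := CDual { cdual_fun :> X -> R^o; _ : cdual_fun \in cdual_pred }.

HB.instance Definition _ := [isSub of cdual for cdual_fun].
HB.instance Definition _ := [Choice of cdual by <:].

Lemma cdual_submod_closed : submod_closed cdual_pred.
Proof.
split; rewrite ?inE /=.
  split; last exact: cst_continuous.
  by move=> a x y; exact: (esym (etrans (addr0 _) (scaler0 _ _))).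
move=> a f g; rewrite !inE /= => -[lf cf] [lg cg]; split.
  move=> b x y; rewrite !fctE/= lf lg !scalerDr !scalerA mulrC addrACA.
  by [].
move=> x; apply: continuousD; last exact: cg.
by apply: (@continuousZl_tmp R R^o) => //; exact: cf.
Qed.

HB.instance Definition _ := GRing.isSubmodClosed.Build R (X -> R^o) cdual_pred
  cdual_submod_closed.
HB.instance Definition _ := [SubChoice_isSubLmodule of cdual by <:].

Let unit_ball : set X := [set x | `|x| <= 1].

Definition cdual_norm (f : cdual) : R := supnorm unit_ball f.

Lemma cdual_linear (f : cdual) : linear f.
Proof. by case: f => f /= /set_mem[]. Qed.

HB.instance Definition _ (f : cdual) :=
  GRing.isLinear.Build R X R^o *:%R (cdual_fun f) (cdual_linear f).

Lemma cdual_bounded (f : cdual) : [bounded f x | x in unit_ball].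
Proof.
have cf : continuous f by case: (f) => g /= /set_mem[].
have [M [Mr gM]] := (linear_boundedP f).1 ((linear_bounded_continuous f).2 cf).
apply: (@le_bounded _ _ _ _ _ (`|M| + 1)) => x /= x1.
apply: (le_trans (gM (`|M| + 1) _ x)).
  by rewrite (le_lt_trans (ler_norm M))// ltrDl.
by rewrite ler_piMr// addr_ge0.
Qed.

Let cdual_normD (f g : cdual) :
  cdual_norm (f + g) <= cdual_norm f + cdual_norm g.
Proof. by apply: supnormD; exact: cdual_bounded. Qed.

Let cdual_normZ (l : R) (f : cdual) :
  cdual_norm (l *: f) = `|l| * cdual_norm f.
Proof. by apply: supnormZ; exact: cdual_bounded. Qed.

Let cdual_norm0_eq0 (f : cdual) : cdual_norm f = 0 -> f = 0.
Proof.
move=> f0; apply/val_inj/funext => x /=.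
have [->|x0] := eqVneq x 0; first exact: linear0.
have xn0 : `|x| != 0 by rewrite normr_eq0.
have fx0 : f (`|x|^-1 *: x) = 0.
  apply/eqP; rewrite -normr_le0 -f0; apply: supnorm_ge.
    exact: cdual_bounded.
  by rewrite /unit_ball /= normrZ normrV ?unitfE// normr_id mulVf.
rewrite -[x]scale1r -(mulfV xn0) -scalerA linearZ/= fx0.
exact: scaler0.
Qed.

HB.instance Definition _ := Lmodule_isNormed.Build R cdual
  cdual_normD cdual_normZ cdual_norm0_eq0.

End ContinuousDual.

Arguments cdual {R} X.

Section BoundedContinuous.
Context {R : realType} {S : topologicalType}.

Definition bcfun_pred : {pred S -> R^o} :=
  mem [set f : S -> R^o | continuous f /\ [bounded f x | x in setT]].

Record bcfun := BCFun { bcfun_fun :> S -> R^o; _ : bcfun_fun \in bcfun_pred }.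

HB.instance Definition _ := [isSub of bcfun for bcfun_fun].
HB.instance Definition _ := [Choice of bcfun by <:].

Lemma bcfun_submod_closed : submod_closed bcfun_pred.
Proof.
split; rewrite ?inE /=.
  split; first exact: cst_continuous.
  by apply: (@le_bounded _ _ _ _ _ 0) => x _; rewrite normr0.
move=> a f g; rewrite !inE /= => -[cf bf] [cg bg]; split.
  move=> x; apply: continuousD; last exact: cg.
  by apply: (@continuousZl_tmp R R^o) => //; exact: cf.
apply: (@le_bounded _ _ _ _ _ (supnorm setT (a *: f) + supnorm setT g)) => x xT.
rewrite (le_trans (ler_normD _ _))// lerD//; last exact: supnorm_ge.
by apply: (@supnorm_ge _ _ _ _ (a *: f)) => //; exact: boundedZ.
Qed.

HB.instance Definition _ := GRing.isSubmodClosed.Build R (S -> R^o) bcfun_pred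
  bcfun_submod_closed.
HB.instance Definition _ := [SubChoice_isSubLmodule of bcfun by <:].

Definition bcfun_norm (f : bcfun) : R := supnorm setT f.

Lemma bcfun_bounded (f : bcfun) : [bounded f x | x in setT].
Proof. by case: f => f /= /set_mem[]. Qed.

Let bcfun_normD (f g : bcfun) :
  bcfun_norm (f + g) <= bcfun_norm f + bcfun_norm g.
Proof. by apply: supnormD; exact: bcfun_bounded. Qed.

Let bcfun_normZ (l : R) (f : bcfun) :
  bcfun_norm (l *: f) = `|l| * bcfun_norm f.
Proof. by apply: supnormZ; exact: bcfun_bounded. Qed.

Let bcfun_norm0_eq0 (f : bcfun) : bcfun_norm f = 0 -> f = 0.
Proof.
move=> f0; apply/val_inj/funext => x /=; apply/eqP.
by rewrite -normr_le0 -f0; apply: supnorm_ge => //; exact: bcfun_bounded.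
Qed.

HB.instance Definition _ := Lmodule_isNormed.Build R bcfun
  bcfun_normD bcfun_normZ bcfun_norm0_eq0.

End BoundedContinuous.

Arguments bcfun R S : clear implicits.

Section BCSets.
Context {R : realType} {X : normedModType R}.

(* BC(X) through representatives: sets at Hausdorff distance 0 (i.e. with the
   same closure) are not identified. The norm, the Radstrom embedding and the
   closure of Minkowski sums and dilations depend only on the closures. *)
Record bcset := BCSet {
  bcset_set :> set X;
  bcset_nonempty : bcset_set !=set0;
  bcset_bounded : bounded_set bcset_set;
  bcset_convex : convex_set bcset_set }.

Definition dual_sphere : set (cdual X) := [set f | `|f| = 1].

Definition ZX := bcfun R (set_type dual_sphere).

Definition set_norm (A : set X) : R := supnorm A id.

Definition set_add (A B : set X) : set X := [set a + b | a in A & b in B].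

Definition set_scale (t : R) (A : set X) : set X := [set t *: a | a in A].

Definition support_fun (A : set X) (f : set_type dual_sphere) : R^o :=
  sup [set (set_val f : cdual X) a | a in A].

Lemma cdual_le (f : cdual X) x : `|f x| <= `|f| * `|x|.
Proof.
have [->|x0] := eqVneq x 0; first by rewrite linear0 !normr0 mulr0.
have xn0 : `|x| != 0 by rewrite normr_eq0.
have -> : f x = `|x| *: f (`|x|^-1 *: x).
  by rewrite -linearZ scalerA mulfV// scale1r.
rewrite normrZ normr_id mulrC ler_wpM2r//.
apply: supnorm_ge; first exact: cdual_bounded.
by rewrite /= normrZ normrV ?unitfE// normr_id mulVf.
Qed.

Lemma support_fun_bcfun (A : bcset) : support_fun A \in @bcfun_pred R _.
Proof.
case: A => A [a0 Aa0] bA cA /=.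
have [M M0 AM] : exists2 M, M > 0 & forall a, A a -> `|a| <= M.
  have /ex_strict_bound_gt0[M M0 AM] := bA.
  by exists M => // a /AM/ltW.
have ubA (f : cdual X) a : A a -> f a <= `|f| * M.
  move=> Aa; apply: (le_trans (ler_norm _)); apply: (le_trans (cdual_le _ _)).
  by rewrite ler_wpM2l// AM.
have hubA (f : cdual X) : has_ubound [set f a | a in A].
  by exists (`|f| * M) => _ /= [a Aa <-]; exact: ubA.
have sup_le (f g : set_type dual_sphere) :
    support_fun A f <= support_fun A g + `|set_val f - set_val g| * M.
  apply: ge_sup; first by exists ((set_val f : cdual X) a0), a0.
  move=> _ /= [a Aa <-].
  rewrite -[leLHS](subrK ((set_val g : cdual X) a)) addrC lerD//.
    by apply: ub_le_sup => //; exists a.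
  exact: (ubA (set_val f - set_val g)).
rewrite inE; split => /=.
  move=> f; apply/(@cvgrPdist_le _ _ _ (nbhs f)) => e e0; near=> g.
  have fg : `|set_val f - set_val g| * M <= e.
    rewrite -ler_pdivlMr//; near: g.
    have : set_val g @[g --> f] --> (set_val f : cdual X).
      exact: initial_continuous.
    by move/cvgr_dist_le; apply; rewrite divr_gt0.
  rewrite ler_distl lerBlDr; apply/andP; split.
    apply: (le_trans (sup_le g f)); rewrite distrC lerD2l//.
  by apply: (le_trans (sup_le f g)); rewrite lerD2l.
apply: (@le_bounded _ _ _ _ _ M) => f _.
have f1 : `|set_val f| = 1 by have := set_valP f.
rewrite ler_norml; apply/andP; split.
  apply: (@le_trans _ _ ((set_val f : cdual X) a0)).
    rewrite lerNl -[leRHS]mul1r -f1.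
    apply: (le_trans (ler_norm _)); rewrite normrN.
    by apply: (le_trans (cdual_le _ _)); rewrite ler_wpM2l// AM.
  by apply: ub_le_sup => //; exists a0.
apply: ge_sup; first by exists ((set_val f : cdual X) a0), a0.
by move=> _ /= [a Aa <-]; rewrite -[leRHS]mul1r -f1; exact: ubA.
Unshelve. all: by end_near. Qed.

Definition radstrom (A : bcset) : ZX := BCFun (support_fun_bcfun A).

Lemma set1_nonempty (x : X) : [set x] !=set0.
Proof. by exists x. Qed.

Lemma bounded_set1_0 : bounded_set [set (0 : X)].
Proof. by apply: (@le_bounded _ _ _ _ _ 0) => _ /= ->; rewrite normr0. Qed.

Lemma convex_set1_0 : convex_set [set (0 : X)].
Proof.
move=> x y l /set_mem -> /set_mem ->; apply/mem_set.
by rewrite /conv/= !scaler0 addr0.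
Qed.

Definition bcset0 : bcset :=
  BCSet (set1_nonempty 0) bounded_set1_0 convex_set1_0.

End BCSets.

Arguments bcset {R} X.
Arguments ZX {R} X.

Section BConvex.
Context {R : realType}.

Definition b_convex (X : normedModType R) :=
  exists (n : nat) (e : R), [/\ (2 <= n)%N, 0 < e &
    forall x : 'I_n -> X, (forall i, `|x i| <= 1) ->
      exists s : 'I_n -> bool,
        `|\sum_(i < n) (-1) ^+ s i *: x i| <= (1 - e) * n%:R].

End BConvex.

Section Bochner.
Context {R : realType} {d : measure_display} {T : measurableType d}
  {V : normedModType R} (mu : {finite_measure set T -> \bar R}).

Definition vsimple (s : T -> V) :=
  finite_set (range s) /\ forall v, measurable (s @^-1` [set v]).

Definition vsimple_integral (s : T -> V) : V :=
  \sum_(v \in range s) fine (mu (s @^-1` [set v])) *: v.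

Definition strongly_measurable (f : T -> V) :=
  exists2 s : nat -> T -> V, (forall k, vsimple (s k)) &
    {ae mu, forall w, s ^~ w @ \oo --> f w}.

(* Strong measurability of f makes this (extended real, nonnegative) integral
   the genuine one. *)
Definition bochner_approx (f : T -> V) (s : nat -> T -> V) :=
  (forall k, vsimple (s k)) /\
  (fun k => \int[mu]_w (`|f w - s k w|)%:E)%E @ \oo --> 0%E.

Definition bochner_integrable (f : T -> V) :=
  strongly_measurable f /\ exists s, bochner_approx f s.

Definition bochner_integral_is (f : T -> V) (v : V) :=
  exists2 s, bochner_approx f s & vsimple_integral (s k) @[k --> \oo] --> v.

End Bochner.

Section Independence.
Context {R : realType} {d : measure_display} {T : measurableType d}
  {V : normedModType R} (P : probability T R).

Definition borel : set (set V) := <<s open >>.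

Definition independent_vectors (xi : nat -> T -> V) :=
  forall (J : seq nat) (B : nat -> set V), uniq J ->
    (forall j, j \in J -> borel (B j)) ->
    P (\bigcap_(j in [set` J]) xi j @^-1` B j) =
    (\prod_(j <- J) P (xi j @^-1` B j))%E.

End Independence.

Section RandomSets.
Context {R : realType} {X : normedModType R} {d : measure_display}
  {T : measurableType d} (P : probability T R).

Definition random_set (F : T -> bcset X) :=
  forall G : set (ZX X), open G -> measurable ((radstrom \o F) @^-1` G).

Definition expectation_is (F : T -> bcset X) (A : bcset X) :=
  bochner_integrable P (radstrom \o F) /\
  bochner_integral_is P (radstrom \o F) (radstrom A).

Definition independent_sets (F : nat -> T -> bcset X) :=
  independent_vectors P (fun n => radstrom \o F n).

End RandomSets.

(* Main.v *)
Require Import Defs.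
From HB Require Import structures.
From mathcomp Require Import all_boot all_order all_algebra.
From mathcomp Require Import all_classical all_reals all_analysis.
From mathcomp Require Import measurable_realfun.
From mathcomp Require Import ring lra.

Set Implicit Arguments.
Unset Strict Implicit.
Unset Printing Implicit Defensive.

Import Order.TTheory GRing.Theory Num.Theory.
Import numFieldNormedType.Exports.

Local Open Scope classical_set_scope.
Local Open Scope ring_scope.

(** Why the theorem holds.

    The hypothesis E(F) = {0} forces F to be almost surely a single point.
    Writing R(A) for the support function of A, the width
    R(F)(g) + R(F)(-g) is nonnegative and has integral 0, so it vanishes almost
    surely for each functional g; strong measurability of R o F makes countably
    many g decide all of them (ae_forall_equilipschitz), and by Hahn-Banach a
    convex set of zero width in every direction is a singleton. Off one null
    set, Psi_i(w) = {x_i(w)}, and R maps points isometrically and linearly, so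
    the statement becomes a strong law for independent centered vectors whose
    values lie in an isometric copy of X. The vectors are kept in Z(X), where
    the measurability and independence hypotheses live; only their norms are
    compared with those of X.

    B-convexity enters through averages over signs. For a nonempty finite
    family of sign patterns of length N let c be a constant such that the mean
    of |sum_i +-x_i|^2 over the family is at most c * sum_i |x_i|^2. The
    triangle and Cauchy-Schwarz inequalities give c = N. B-convexity improves
    this to c = theta * n with theta < 1 for one length n
    (b_convex_sign_type), and constants multiply when lengths do (sign_typeM):
    take the tensor product of two families, the same inner pattern being used
    in every block. Hence c is smaller than N by a power of N
    (b_convex_growth_rate).

    Independence and centering give E|S_N|^2 <= 4 E|sum_i +-xi_i|^2 for every
    fixed choice of signs (symmetrization): if the sum is split into S_I and
    S_J according to the sign, then E|S_I|^2 <= E|S_I - S_J|^2, as conditioning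
    on the terms of S_I averages S_J to 0. Averaging over a good family of
    signs bounds E|S_N|^2 by 4 c N sup_i E|xi_i|^2, which beats N^2 by a power
    of N.

    With such a rate no maximal inequality is needed. Along N_k = (k+1)^a, with
    a large, E|S_(N_k)/N_k|^2 is O(1/k^2), and the crude bound of S_n - S_(N_k)
    by the sum of |xi_i| over the block N_k <= i < N_(k+1), whose length is
    O(N_k / k), is O(1/k^2) in mean square too. Both series of expectations
    converge, so the averages tend to 0 almost surely (slln_of_moments). *)

(** * Norming functionals *)

Section HahnBanach.
Context {R : realType} {X : normedModType R}.

(** Partial linear functionals bounded by the norm, encoded by their graphs so
    that the union of a chain of them is again one; single-valuedness follows
    from the bound at 0. *)
Definition dominated_linear_graph (G : set (X * R)) :=
  (forall t p q, G p -> G q -> G (t *: p.1 + q.1, t * p.2 + q.2)) /\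
  (forall p, G p -> p.2 <= `|p.1|).

(** The value c at y must satisfy b - |x - y| <= c <= |x + y| - b for all (x, b)
    in the graph; by the triangle inequality every lower bound is below every
    upper bound, so the supremum of the lower ones works. *)
Lemma extend_dominated_graph (G : set (X * R)) (y : X) :
  dominated_linear_graph G -> G (0, 0) ->
  exists c, dominated_linear_graph
    [set (p.1 + t *: y, p.2 + t * c) | p in G & t in [set: R]].
Proof.
move=> [Glin Gle] G0.
pose E := [set p.2 - `|p.1 - y| | p in G].
have GB p q : G p -> G q -> p.2 - `|p.1 - y| <= `|q.1 + y| - q.2.
  move=> Gp Gq; rewrite lerBrDr addrAC lerBlDr.
  have /= := Gle _ (Glin 1 _ _ Gp Gq); rewrite scale1r mul1r => /le_trans; apply.
  rewrite (_ : p.1 + q.1 = (q.1 + y) + (p.1 - y)); first exact: ler_normD.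
  by rewrite addrACA subrr addr0 addrC.
have Enon : E !=set0 by exists (0 - `|0 - y|), (0, 0).
have supE : has_sup E.
  by split=> //; exists (`|0 + y| - 0) => _ [p Gp <-]; exact: (GB p (0, 0)).
have cle p : G p -> p.2 - `|p.1 - y| <= sup E.
  by move=> Gp; apply: ub_le_sup; [exact: supE.2|exists p].
have cge q : G q -> sup E <= `|q.1 + y| - q.2.
  by move=> Gq; apply: ge_sup => // _ [p Gp <-]; exact: GB.
exists (sup E); split=> [t _ _ [p Gp [a _ <-]] [q Gq [b _ <-]]|_ [p Gp [t _ <-]]] /=.
  exists (t *: p.1 + q.1, t * p.2 + q.2); first exact: Glin.
  exists (t * a + b) => //=; congr pair; last by ring.
  by rewrite scalerDr scalerDl scalerA addrACA.
have Gs s : G (s *: p.1, s * p.2).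
  by have := Glin s _ _ Gp G0; rewrite !addr0.
have [t0|t0|->] := ltrgtP t 0; last by rewrite scale0r mul0r !addr0; exact: Gle.
  have s0 : 0 < - t by rewrite oppr_gt0.
  have sn0 : - t != 0 by rewrite gt_eqF.
  have -> : p.1 + t *: y = - t *: ((- t)^-1 *: p.1 - y).
    by rewrite scalerBr scalerA divff// scale1r scaleNr opprK.
  rewrite normrZ gtr0_norm//; have := cle _ (Gs (- t)^-1) => /=.
  by rewrite -(ler_pM2l s0) mulrBr mulrA divff// mul1r; lra.
have tn0 : t != 0 by rewrite gt_eqF.
have -> : p.1 + t *: y = t *: (t^-1 *: p.1 + y).
  by rewrite scalerDr scalerA divff// scale1r.
rewrite normrZ gtr0_norm//; have := cge _ (Gs t^-1) => /=.
by rewrite -(ler_pM2l t0) mulrBr mulrA divff// mul1r; lra.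
Qed.

(** Zorn's lemma applied to the dominated graphs that are empty or contain
    (x0, |x0|): the empty graph has to be admitted because it is the union of
    the empty chain. *)
Lemma dominated_graph_total (x0 : X) :
  exists G : set (X * R), [/\ dominated_linear_graph G, G (x0, `|x0|) &
    forall x, exists a, G (x, a)].
Proof.
pose P (G : set (X * R)) :=
  dominated_linear_graph G /\ (G !=set0 -> G (x0, `|x0|)).
have [F FP Ftot|G [[[Glin Gle] Gx0] Gmax]] := @Zorn_bigcup _ P.
  split; last by move=> [p [A FA Ap]]; exists A => //; apply: (FP _ FA).2; exists p.
  split=> [t p q [A FA Ap] [B FB Bq]|p [A FA Ap]]; last exact: (FP _ FA).1.2.
  have [AB|BA] := Ftot _ _ FA FB.
    by exists B => //; apply: (FP _ FB).1.1 => //; exact: AB.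
  by exists A => //; apply: (FP _ FA).1.1 => //; exact: BA.
have {}Gx0 : G (x0, `|x0|).
  apply: Gx0; apply/set0P/negP => /eqP G0.
  (* the line spanned by x0 is strictly larger than the empty graph *)
  apply: (Gmax [set (t *: x0, t * `|x0|) | t in [set: R]]).
    rewrite G0; split=> // /(_ (0 *: x0, 0 * `|x0|)); apply.
    by exists 0.
  split; last by move=> _; exists 1 => //; rewrite scale1r mul1r.
  split=> [t _ _ [a _ <-] [b _ <-]|_ [t _ <-]] /=.
    exists (t * a + b) => //; congr pair; last by ring.
    by rewrite scalerDl scalerA.
  by rewrite normrZ ler_wpM2r// ler_norm.
exists G; split=> // y; apply: contrapT => nGy.
have G0 : G (0, 0).
  by have := Glin (-1) _ _ Gx0 Gx0; rewrite /= scaleN1r mulN1r !addNr.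
have [c Gc] := extend_dominated_graph y (conj Glin Gle) G0.
apply: (Gmax _ _ (conj Gc _)); last first.
  by move=> _; exists (x0, `|x0|) => //; exists 0 => //=; rewrite scale0r mul0r !addr0.
split.
  by move=> [a b] Gab; exists (a, b) => //; exists 0 => //=; rewrite scale0r mul0r !addr0.
move=> /(_ (y, c)) h; apply: nGy; exists c; apply: h.
by exists (0, 0) => //; exists 1 => //=; rewrite scale1r mul1r !add0r.
Qed.

Lemma cdual_of_dominated (f : X -> R) :
  linear (f : X -> R^o) -> (forall x, f x <= `|x|) ->
  exists2 g : cdual X, `|g| <= 1 & forall x, g x = f x.
Proof.
move=> flin fle.
pose h := HB.pack_for {linear X -> R^o} (f : X -> R^o)
  (GRing.isLinear.Build R X R^o *:%R f flin).
have fabs y : `|f y| <= `|y|.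
  rewrite ler_norml fle andbT lerNl.
  by have -> : - f y = h (- y) by [rewrite linearN]; rewrite (le_trans (fle _)) ?normrN.
have fcont : continuous (f : X -> R^o).
  apply: (@linear_bounded_continuous _ _ _ h).1; apply/linear_boundedP.
  exists 1; split=> // r r1 y; apply: (le_trans (fabs y)).
  by rewrite ler_peMl// ltW.
have fP : (f : X -> R^o) \in cdual_pred by rewrite inE; split.
exists (CDual fP) => //; apply: supnorm_le => // x /= x1.
exact: le_trans (fabs x) x1.
Qed.

(** The Hahn-Banach theorem in the form used below. The norm of f is only said
    to be at most 1 so that x = 0 is covered even if X is trivial. *)
Lemma norming_functional (x : X) : exists2 f : cdual X, `|f| <= 1 & f x = `|x|.
Proof.
have [G [[Glin Gle] Gx Gtot]] := dominated_graph_total x.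
have [f Gf] := choice Gtot.
have Gu y a b : G (y, a) -> G (y, b) -> a = b.
  move=> Ga Gb; apply/eqP; rewrite eq_le.
  have := Gle _ (Glin (-1) _ _ Ga Gb); have := Gle _ (Glin (-1) _ _ Gb Ga).
  by rewrite /= !scaleN1r addNr normr0; lra.
have [||g g1 gf] := @cdual_of_dominated f.
- move=> t y z; apply: (Gu (t *: y + z)) => //.
  exact: (Glin t (y, f y) (z, f z)).
- by move=> y; exact: (Gle (y, f y)).
exists g => //; rewrite gf; exact: (Gu x).
Qed.

Lemma norming_functional1 (x : X) : x != 0 ->
  exists2 f : cdual X, `|f| = 1 & f x = `|x|.
Proof.
move=> x0; have [f f1 fx] := norming_functional x; exists f => //.
apply/eqP; rewrite eq_le f1 /= -(ler_pM2r (_ : 0 < `|x|)) ?normr_gt0// mul1r.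
by rewrite -{1}fx (le_trans (ler_norm _)) ?cdual_le.
Qed.

End HahnBanach.

(** * Sign averages in B-convex spaces *)

Section SignType.
Context {R : realType} {X : normedModType R}.

(** c is a constant for sums of N vectors over some finite family T of sign
    patterns. Leaving the family free, rather than averaging over all patterns,
    is what makes the products of sign_typeM immediate. *)
Definition sign_type (N : nat) (c : R) :=
  exists (T : finType) (s : T -> nat -> bool), (0 < #|T|)%N /\
    forall x : nat -> X,
      \sum_(t : T) `|\sum_(i < N) (-1) ^+ s t i *: x i| ^+ 2 <=
      #|T|%:R * c * \sum_(i < N) `|x i| ^+ 2.

Lemma sign_type1 : sign_type 1 1.
Proof.
exists unit, (fun _ _ => false); rewrite card_unit; split=> // x.
rewrite big_const card_unit /= addr0 !mul1r.
by rewrite !big_ord1 expr0 scale1r.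
Qed.

(** Pad the vectors with zeros. *)
Lemma sign_typeS N N' c : (N <= N')%N -> sign_type N' c -> sign_type N c.
Proof.
move=> NN' [T [s [T0 sP]]]; exists T, s; split=> // x.
have pad (V : nmodType) (F : nat -> V) :
    \sum_(i < N) F i = \sum_(i < N') (if (i < N)%N then F i else 0).
  by rewrite (big_ord_widen N' F NN') big_mkcond.
have := sP (fun i => if (i < N)%N then x i else 0).
rewrite (pad _ (fun i => `|x i| ^+ 2)).
have -> : \sum_(i < N') `|if (i < N)%N then x i else 0| ^+ 2 =
    \sum_(i < N') (if (i < N)%N then `|x i| ^+ 2 else 0).
  by apply: eq_bigr => i _; case: ifP => //; rewrite normr0 expr0n.
move=> h; apply: le_trans h; rewrite le_eqVlt; apply/orP; left; apply/eqP.
apply: eq_bigr => t _; congr (`|_| ^+ 2); rewrite (pad _ (fun i => (-1) ^+ s t i *: x i)).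
by apply: eq_bigr => i _; case: ifP => //; rewrite scaler0.
Qed.

(** Cut a sum of N * M vectors into N blocks of length M. A pair of patterns
    (t, t') signs the i-th term of the j-th block by s t j + s' t' i. For fixed
    t' the first inequality applies to the N signed block sums, then the second
    one applies inside each block. *)
Lemma sign_typeM N M c d : 0 <= c -> sign_type N c -> sign_type M d ->
  sign_type (N * M) (c * d).
Proof.
move=> c0 [T [s [T0 sP]]] [T' [s' [T'0 s'P]]].
exists (T * T')%type, (fun t i => s t.1 (i %/ M)%N (+) s' t.2 (i %% M)%N).
rewrite card_prod muln_gt0 T0 T'0; split=> // x.
have [->|M0] := posnP M.
  rewrite muln0 !big_ord0 mulr0 big1// => t _.
  by rewrite big_ord0 normr0 expr0n.
have blocks (V : nmodType) (F : nat -> V) :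
    \sum_(i < N * M) F i = \sum_(j < N) \sum_(i < M) F (j * M + i)%N.
  rewrite -(big_mkord xpredT F) big_nat_mul big_mkord; apply: eq_bigr => j _.
  rewrite mulSn addnC -{1}[(j * M)%N]add0n big_addn addKn.
  by rewrite big_mkord; apply: eq_bigr => i _; rewrite addnC.
pose Y t' j := \sum_(i < M) (-1) ^+ s' t' i *: x (j * M + i)%N.
have -> : \sum_(t : T * T') `|\sum_(i < N * M)
      (-1) ^+ (s t.1 (i %/ M)%N (+) s' t.2 (i %% M)%N) *: x i| ^+ 2 =
    \sum_(t' : T') \sum_(t : T) `|\sum_(j < N) (-1) ^+ s t j *: Y t' j| ^+ 2.
  rewrite exchange_big/= pair_big/=; apply: eq_bigr => -[t t'] _ /=.
  rewrite (blocks _ (fun i => (-1) ^+ (s t (i %/ M)%N (+) s' t' (i %% M)%N) *: x i)).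
  congr (`|_| ^+ 2); apply: eq_bigr => j _; rewrite scaler_sumr.
  apply: eq_bigr => i _; rewrite scalerA -signr_addb.
  by rewrite divnMDl// divn_small// addn0 modnMDl modn_small.
rewrite (blocks _ (fun i => `|x i| ^+ 2)) natrM.
apply: (@le_trans _ _ (\sum_(t' : T') (#|T|%:R * c * \sum_(j < N) `|Y t' j| ^+ 2))).
  by apply: ler_sum => t' _; exact: sP.
rewrite -mulr_sumr exchange_big/=.
rewrite (_ : #|T|%:R * #|T'|%:R * (c * d) = #|T|%:R * c * (#|T'|%:R * d)); last by ring.
rewrite -[leRHS]mulrA; apply: ler_wpM2l; first by rewrite mulr_ge0.
by rewrite mulr_sumr; apply: ler_sum => j _; exact: (s'P (fun i => x (j * M + i)%N)).
Qed.

Lemma sign_typeX N c k : 0 <= c -> sign_type N c -> sign_type (N ^ k) (c ^+ k).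
Proof.
move=> c0 Nc; elim: k => [|k IHk]; first exact: sign_type1.
by rewrite expnS exprS; exact: sign_typeM.
Qed.

Lemma ler_sqr_ge0 (a b : R) : 0 <= a -> a <= b -> a ^+ 2 <= b ^+ 2.
Proof. by move=> a0 ab; apply: lerXn2r; rewrite ?nnegrE// (le_trans a0). Qed.

(** n * sum a_i^2 - (sum a_i)^2 is the sum of the squared deviations
    (n * a_i - sum a)^2, divided by n; a single deviation is kept. *)
Lemma sumr_sqr_defect n (a : 'I_n -> R) (k : 'I_n) :
  (\sum_i a i) ^+ 2 + (n%:R * a k - \sum_i a i) ^+ 2 / n%:R <=
  n%:R * \sum_i a i ^+ 2.
Proof.
have n0 : 0 < n%:R :> R by rewrite ltr0n (leq_ltn_trans _ (ltn_ord k)).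
set S := \sum_i a i.
have -> : n%:R * \sum_i a i ^+ 2 = S ^+ 2 + (\sum_i (n%:R * a i - S) ^+ 2) / n%:R.
  under [X in _ = _ + X / _]eq_bigr do rewrite sqrrB -[_ *+ 2]mulr_natl.
  rewrite big_split/= sumrB sumr_const card_ord.
  under [X in _ = _ + (X - _ + _) / _]eq_bigr do rewrite exprMn.
  under [X in _ = _ + (_ - X + _) / _]eq_bigr do rewrite mulrA mulrA [2 * _ * _ * S]mulrAC.
  rewrite -!mulr_sumr -/S -[_ *+ n]mulr_natl; field.
  by rewrite gt_eqF.
rewrite lerD2l ler_wpM2r ?invr_ge0 ?(ltW n0)//.
by rewrite (bigD1 k)//= lerDl sumr_ge0// => i _; rewrite sqr_ge0.
Qed.

(** Use all 2^n patterns. Every signed sum is at most S = sum |x_i|, and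
    S^2 <= n * sum |x_i|^2. If the largest norm exceeds (1 + e) times the mean
    norm, the Cauchy-Schwarz inequality is strict by a fixed factor. Otherwise
    B-convexity, applied after dividing by the largest norm, yields a pattern
    whose sum is at most (1 - e) (1 + e) S, which lowers the average over the
    patterns by a fixed factor. *)
Lemma b_convex_sign_type : b_convex X ->
  exists n th, [/\ (2 <= n)%N, 0 <= th, th < 1 & sign_type n (th * n%:R)].
Proof.
move=> [n [e [n2 e0 BX]]].
have n0 : 0 < n%:R :> R by rewrite ltr0n (leq_trans _ n2).
(* at x = 0 the defining inequality reads 0 <= (1 - e) * n *)
have e1 : e <= 1.
  have [i|s] := BX (fun=> 0); first by rewrite normr0.
  by move=> /(le_trans (normr_ge0 _)); rewrite pmulr_lge0// subr_ge0.
pose T : finType := {ffun 'I_n -> bool}.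
pose K : R := #|T|%:R.
have T0 : (0 < #|T|)%N by rewrite card_ffun card_bool expn_gt0.
have K0 : 0 < K by rewrite ltr0n.
have K1 : 1 <= K by rewrite ler1n.
pose q := 1 - e ^+ 2.
have q0 : 0 <= q by rewrite subr_ge0 expr_le1// ltW.
have q1 : q < 1 by rewrite gtrBl exprn_gt0.
have q21 : 0 < 1 - q ^+ 2 by rewrite subr_gt0 expr_lt1.
pose th1 := (1 + e ^+ 2 / n%:R)^-1.
pose th2 := 1 - (1 - q ^+ 2) / K.
have d0 : 0 < e ^+ 2 / n%:R by rewrite divr_gt0// exprn_gt0.
have th10 : 0 <= th1 by rewrite invr_ge0 addr_ge0// ltW.
have th11 : th1 < 1 by rewrite invf_lt1 ?ltrDl// addr_gt0.
have th21 : th2 < 1 by rewrite gtrBl divr_gt0.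
exists n, (Num.max th1 th2); split=> //.
- by rewrite le_max th10.
- by rewrite gt_max th11.
pose sg (t : {ffun 'I_n -> bool}) (i : nat) :=
  if insub i is Some j then t j else false.
exists T, sg; split=> // x.
pose v (t : {ffun 'I_n -> bool}) := `|\sum_(i < n) (-1) ^+ t i *: x i|.
have -> : \sum_(t : T) `|\sum_(i < n) (-1) ^+ sg t i *: x i| ^+ 2 =
    \sum_(t : T) v t ^+ 2.
  apply: eq_bigr => t _; congr (`|_| ^+ 2); apply: eq_bigr => i _.
  by rewrite /sg valK.
pose a (i : 'I_n) := `|x i|; pose S := \sum_i a i; pose Q := \sum_i a i ^+ 2.
rewrite -/K -/Q.
have Q0 : 0 <= Q by apply: sumr_ge0 => i _; rewrite sqr_ge0.
have S0 : 0 <= S by apply: sumr_ge0 => i _; exact: normr_ge0.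
have vS t : v t ^+ 2 <= S ^+ 2.
  apply: ler_sqr_ge0; first exact: normr_ge0.
  rewrite /v (le_trans (ler_norm_sum _ _ _))//.
  by apply: ler_sum => i _; rewrite normrZ normrX normrN1 expr1n mul1r.
suff [h|h] : S ^+ 2 <= th1 * (n%:R * Q) \/
    (S ^+ 2 <= n%:R * Q /\ exists t, v t <= q * S).
- apply: (@le_trans _ _ (\sum_(t : T) S ^+ 2)); first exact: ler_sum.
  rewrite sumr_const -[_ *+ _]mulr_natl -/K -mulrA ler_wpM2l ?(ltW K0)//.
  by rewrite (le_trans h)// -mulrA ler_wpM2r ?mulr_ge0 ?(ltW n0)// le_max lexx.
- move: h => [SQ [t vt]].
  apply: (@le_trans _ _ (K * th2 * S ^+ 2)).
    rewrite (bigD1 t)//= (_ : K * th2 * S ^+ 2 = (q * S) ^+ 2 + (K - 1) * S ^+ 2).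
      rewrite lerD//; first by apply: ler_sqr_ge0 => //; exact: normr_ge0.
      apply: (@le_trans _ _ (\sum_(i | i != t) S ^+ 2)); first exact: ler_sum.
      rewrite sumr_const -[_ *+ _]mulr_natl cardC1 -subn1 natrB//.
    by rewrite /th2; field; rewrite gt_eqF.
  have th20 : 0 <= th2.
    rewrite subr_ge0 ler_pdivrMr// mul1r (le_trans _ K1)//.
    by rewrite gerBl sqr_ge0.
  apply: (@le_trans _ _ (K * th2 * (n%:R * Q))).
    by rewrite ler_wpM2l// mulr_ge0// ltW.
  rewrite -!mulrA ler_wpM2l ?(ltW K0)// ler_wpM2r ?mulr_ge0 ?(ltW n0)//.
  by rewrite le_max lexx orbT.
have i0 : 'I_n by exact: (Ordinal (ltnW n2)).
have [k _ km] := @Order.TotalTheory.arg_maxP _ _ _ i0 xpredT a isT.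
have am i : a i <= a k by exact: km.
have defect := sumr_sqr_defect a k; rewrite -/S -/Q in defect.
have [SA|SB] := leP ((1 + e) * S) (n%:R * a k); [left|right].
  rewrite /th1 ler_pdivlMl; last by rewrite addr_gt0.
  apply: le_trans defect; rewrite mulrDl mul1r lerD2l mulrAC ler_wpM2r ?invr_ge0 ?(ltW n0)//.
  by rewrite -exprMn; apply: ler_sqr_ge0; [rewrite mulr_ge0// ltW|lra].
split.
  by apply: le_trans defect; rewrite lerDl divr_ge0 ?sqr_ge0// ltW.
have Sk : S <= n%:R * a k.
  apply: (@le_trans _ _ (\sum_(i < n) a k)); first exact: ler_sum.
  by rewrite sumr_const card_ord mulr_natl.
have ak0 : 0 < a k.
  rewrite lt_neqAle normr_ge0 andbT eq_sym; apply/eqP => ak0.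
  by move: SB Sk; rewrite ak0 mulr0 => SB Sk; nra.
have [i|s sP] := BX (fun i => (a k)^-1 *: x i).
  by rewrite normrZ normfV (gtr0_norm ak0) ler_pdivrMl// mulr1; exact: am.
exists [ffun i => s i].
have -> : v [ffun i => s i] = a k * `|\sum_(i < n) (-1) ^+ s i *: ((a k)^-1 *: x i)|.
  rewrite -{1}(gtr0_norm ak0) -normrZ scaler_sumr /v; congr `|_|.
  apply: eq_bigr => i _; rewrite ffunE !scalerA; congr (_ *: _).
  by field; rewrite gt_eqF.
apply: (@le_trans _ _ (a k * ((1 - e) * n%:R))); first by rewrite ler_wpM2l ?(ltW ak0).
rewrite /q; nra.
Qed.

End SignType.
Arguments sign_type {R} X.

Section GrowthRate.
Context {R : realType} {X : normedModType R}.

(** With theta < 1 and theta * n a constant for length n, the constant for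
    length n^J is theta^J * n^J. Choose a with theta^a <= n^-2; if
    n^j <= k + 1 <= n^(j+1), then J = (j+1) * a suffices for (k+1)^a vectors
    and theta^J <= (k+1)^-2. *)
Lemma b_convex_growth_rate : b_convex X ->
  exists (a : nat) (C : R), [/\ (0 < a)%N, 0 <= C &
    forall k, exists c, [/\ 0 <= c, sign_type X (k.+1 ^ a) c &
      c <= C * k.+1%:R ^+ a / k.+1%:R ^+ 2]].
Proof.
move=> /b_convex_sign_type[n [th [n2 th0 th1 nth]]].
have n0 : 0 < n%:R :> R by rewrite ltr0n (leq_trans _ n2).
have [a a0 tha] : exists2 a, (0 < a)%N & th ^+ a <= n%:R ^- 2.
  have : (th ^+ a @[a --> \oo] --> (0 : R))%classic.
    by apply: cvg_expr; rewrite ger0_norm.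
  move=> /cvgr0_norm_le /(_ (n%:R ^- 2)).
  rewrite invr_gt0 exprn_gt0// => /(_ isT)[a _ /(_ a.+1 (leqnSn a))] /=.
  by rewrite ger0_norm ?exprn_ge0// => h; exists a.+1.
exists a, (n%:R ^+ a); split=> // k; pose j := trunc_log n k.+1.
have nj : (n ^ j <= k.+1)%N by exact: trunc_logP.
have nSj : (k.+1 <= n ^ j.+1)%N by rewrite ltnW// trunc_log_ltn.
exists ((th * n%:R) ^+ (j.+1 * a)); split.
- by rewrite exprn_ge0// mulr_ge0// ltW.
- apply: (@sign_typeS _ _ _ (n ^ (j.+1 * a))); first by rewrite expnM leq_exp2r.
  by apply: sign_typeX => //; rewrite mulr_ge0// ltW.
rewrite exprMn mulrC; apply: ler_pM.
- by rewrite exprn_ge0// ltW.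
- by rewrite exprn_ge0.
- rewrite mulSn exprD ler_wpM2l ?exprn_ge0 ?(ltW n0)// exprM.
  by rewrite lerXn2r ?nnegrE ?exprn_ge0 ?(ltW n0)// -natrX ler_nat.
rewrite mulnC exprM (@le_trans _ _ ((n%:R ^- 2) ^+ j.+1))//.
  by rewrite lerXn2r ?nnegrE ?exprn_ge0// invr_ge0 exprn_ge0// ltW.
rewrite exprVn lef_pV2 ?posrE ?exprn_gt0// -exprM mulnC exprM.
by rewrite lerXn2r ?nnegrE ?exprn_ge0// ?(ltW n0)// -natrX ler_nat.
Qed.

End GrowthRate.

(** * Borel measurable and strongly measurable vectors *)

Section BorelVectors.
Context {R : realType} {V : normedModType R}.

Lemma borel_open (G : set V) : open G -> borel G.
Proof. exact: sub_sigma_algebra. Qed.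

Lemma borel_setD (A B : set V) : borel A -> borel B -> borel (A `\` B).
Proof.
exact: (@measurableD _ (g_sigma_algebraType (@open V))).
Qed.

Lemma borel_continuous (g : V -> R) (B : set R) :
  continuous g -> measurable B -> borel (g @^-1` B).
Proof.
move=> gc mB.
have mg : measurable_fun setT (g : g_sigma_algebraType (@open V) -> R).
  apply: (measurability _ (RGenOInfty.measurableE R)) => _ [_ [x ->] <-].
  rewrite setTI; apply: borel_open; rewrite set_itvoy; apply: open_comp; last exact: open_gt.
  by move=> ? _; exact: gc.
by rewrite -[_ @^-1` _]setTI; exact: mg.
Qed.

End BorelVectors.

Section RandomVectors.
Context {R : realType} {d : measure_display} {Omega : measurableType d}
  {V : normedModType R}.
Implicit Types (f g : Omega -> V).

Definition borel_measurable f := forall B, borel B -> measurable (f @^-1` B).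

(** Strong measurability without exceptional set. Unlike Borel measurability it
    is stable under sums when V is not separable. *)
Definition simple_limit f :=
  exists2 s : nat -> Omega -> V, (forall k, vsimple (s k)) &
    forall w, s ^~ w @ \oo --> f w.

Lemma borel_measurable_open f :
  (forall G, open G -> measurable (f @^-1` G)) -> borel_measurable f.
Proof.
move=> fo; apply: smallest_sub => //; split.
- by rewrite preimage_set0.
- move=> A mA; rewrite /= setTD preimage_setC; exact: measurableC.
- by move=> A mA; rewrite /= preimage_bigcup; exact: bigcupT_measurable.
Qed.

Lemma borel_measurable_comp f (g : V -> R) :
  borel_measurable f -> continuous g -> measurable_fun setT (g \o f).
Proof.
move=> bf cg _ B mB; rewrite setTI comp_preimage.
by apply: bf; apply: (borel_continuous cg).
Qed.

Lemma borel_measurable_norm f : borel_measurable f ->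
  measurable_fun setT (fun w => `|f w|).
Proof. by move=> bf; apply: (borel_measurable_comp bf); exact: norm_continuous. Qed.

Lemma cdual_continuous (phi : cdual V) : continuous (phi : V -> R^o).
Proof. by case: phi => g /= /set_mem[]. Qed.

Lemma vsimple_preimage (s : Omega -> V) (B : set V) :
  vsimple s -> measurable (s @^-1` B).
Proof.
move=> [fs ms].
rewrite (_ : s @^-1` B = \bigcup_(v in range s `&` B) s @^-1` [set v]).
  by apply: fin_bigcup_measurable => // ; exact: finite_setIl.
apply/seteqP; split=> [w Bw|w [v [_ Bv]] /= -> //].
by exists (s w) => //; split=> //; exists w.
Qed.

Lemma vsimple_cst (v : V) : vsimple (cst v : Omega -> V).
Proof.
split=> [|u]; first by apply: (@sub_finite_set _ _ [set v]) => // _ [w _ <-].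
by rewrite preimage_cst; case: ifP.
Qed.

Lemma vsimple_lin a (s t : Omega -> V) :
  vsimple s -> vsimple t -> vsimple (fun w => a *: s w + t w).
Proof.
move=> vs vt; split.
  apply: (@sub_finite_set _ _ [set a *: u + v | u in range s & v in range t]).
    by move=> _ [w _ <-]; exists (s w); [exists w|exists (t w) => //; exists w].
  exact: (finite_image2 _ vs.1 vt.1).
move=> v.
rewrite (_ : _ @^-1` _ = \bigcup_(u in range s)
    (s @^-1` [set u] `&` t @^-1` [set v - a *: u])).
  apply: fin_bigcup_measurable => [|u _]; first exact: vs.1.
  by apply: measurableI; [exact: vs.2|exact: vt.2].
apply/seteqP; split=> [w /= <-|w [u _ [/= -> ->]]].
  by exists (s w); [exists w|split=> //=; rewrite addrAC subrr add0r].
by rewrite /= addrC subrK.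
Qed.

Lemma simple_limit0 : simple_limit (cst 0).
Proof.
by exists (fun=> cst 0) => [k|w]; [exact: vsimple_cst|exact: cvg_cst].
Qed.

Lemma simple_limit_lin a f g :
  simple_limit f -> simple_limit g -> simple_limit (fun w => a *: f w + g w).
Proof.
move=> [s vs sf] [t vt tg]; exists (fun k w => a *: s k w + t k w) => [k|w].
  exact: vsimple_lin.
by apply: cvgD; [apply: cvgZl_tmp; exact: sf|exact: tg].
Qed.

Lemma simple_limit_comp f (g : V -> R) : simple_limit f -> continuous g ->
  measurable_fun setT (g \o f).
Proof.
move=> [s vs sf] gc; apply: (@measurable_fun_cvg _ _ _ setT (fun k => g \o s k)).
  by move=> k _ B mB; rewrite setTI; exact: (vsimple_preimage (g @^-1` B) (vs k)).
by move=> w _; apply: (cvg_comp _ _ (sf w)); exact: gc.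
Qed.

Lemma simple_limit_norm f : simple_limit f -> measurable_fun setT (fun w => `|f w|).
Proof. by move=> sf; apply: (simple_limit_comp sf); exact: norm_continuous. Qed.

(** The values of the approximating simple functions form a countable set whose
    eta-balls cover the range of f; B is the disjointed sequence of these
    balls. *)
Lemma simple_limit_cells f (eta : R) : simple_limit f -> 0 < eta ->
  exists (B : nat -> set V) (c : nat -> V), [/\ forall k, borel (B k),
    trivIset setT B, forall w, exists k, B k (f w) &
    forall k v, B k v -> `|v - c k| < eta].
Proof.
move=> [s vs sf] eta0.
pose D := \bigcup_k range (s k).
have cD : countable D.
  by apply: bigcup_countable => // k _; exact/finite_set_countable/(vs k).1.
have /countable_injP[g ginj] := cD.
pose c n : V := get [set v | D v /\ g v = n].
have cP v : D v -> c (g v) = v.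
  move=> Dv; rewrite /c; case: xgetP => [u _ [Du guv]|/(_ v)[]//].
  by apply: ginj => //; apply/mem_set.
exists (seqDU (fun k => ball (c k) eta)), c; split.
- move=> k; rewrite /seqDU; apply: borel_setD.
    by apply: borel_open; exact: ball_open.
  apply: borel_open; elim/big_ind: _ => [|A B oA oB|i _]; first exact: open0.
    exact: openU.
  exact: ball_open.
- exact: trivIset_seqDU.
- move=> w; have : (\bigcup_k ball (c k) eta) (f w).
    have /cvgr_dist_lt /(_ _ eta0) [k _ /(_ k (leqnn k)) fk] := sf w.
    exists (g (s k w)) => //; rewrite cP ?/D; last by exists k => //; exists w.
    by rewrite -ball_normE /= distrC.
  by rewrite seqDU_bigcup_eq => -[k _ Bk]; exists k.
- move=> k v [+ _]; rewrite -ball_normE /= distrC.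
  exact.
Qed.

End RandomVectors.

(** * Integration over an independent event *)

Section IndependentIntegral.
Context {R : realType} {d : measure_display} {Omega : measurableType d}
  (P : probability Omega R).
Local Open Scope ereal_scope.

Lemma ge0_integral_mrestr (A : set Omega) (mA : measurable A) (f : Omega -> \bar R) :
  measurable_fun setT f -> (forall w, 0 <= f w) ->
  \int[mrestr P mA]_w f w = \int[P]_(w in A) f w.
Proof.
move=> mf f0.
rewrite (@ge0_negligible_integral _ _ _ _ _ (~` A))//; last first.
- by rewrite /= /mrestr setICl measure0.
- exact: measurableC.
rewrite setTD setCK; apply: eq_measure_integral => B mB BA.
by rewrite /= /mrestr; congr (P _); apply/setIidPl.
Qed.

(** Both sides are integrals of f against image measures under h: of P
    restricted to A, and of P scaled by P A. The hypothesis says that these two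
    measures agree. *)
Lemma ge0_indep_integral (A : set Omega) (h : Omega -> R) (f : R -> \bar R) :
  measurable A -> measurable_fun setT h ->
  (forall B, measurable B -> P (A `&` h @^-1` B) = P A * P (h @^-1` B)) ->
  measurable_fun setT f -> (forall x, 0 <= f x) ->
  \int[P]_(w in A) f (h w) = P A * \int[P]_w f (h w).
Proof.
move=> mA mh indep mf f0.
have mfh : measurable_fun setT (f \o h) by exact: measurableT_comp.
have p0 : (0 <= fine (P A))%R by exact: fine_ge0.
pose p := NngNum p0.
have pE : p%:num%:E = P A by rewrite /= fineK// fin_num_measure.
have transfer (m : {measure set Omega -> \bar R}) :
    \int[m]_w f (h w) = \int[pushforward m h]_y f y.
  by rewrite (ge0_integral_pushforward mh).
rewrite -(ge0_integral_mrestr mA mfh); last by move=> w; exact: f0.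
rewrite (_ : \int[P]_w f (h w) = \int[pushforward P h]_y f y); last first.
  exact: transfer.
rewrite -pE -ge0_integral_mscale// transfer.
apply: eq_measure_integral => B mB _.
rewrite /= /mscale /pushforward /= /mrestr /= fineK ?fin_num_measure//.
by rewrite setIC indep.
Qed.

Lemma indep_integral (A : set Omega) (h : Omega -> R) :
  measurable A -> measurable_fun setT h ->
  (forall B, measurable B -> P (A `&` h @^-1` B) = P A * P (h @^-1` B)) ->
  P.-integrable setT (EFin \o h) ->
  \int[P]_(w in A) (h w)%:E = P A * \int[P]_w (h w)%:E.
Proof.
move=> mA mh indep ih.
rewrite integralE [in RHS]integralE.
have mE : measurable_fun [set: R] (EFin : R -> \bar R).
  by apply/measurable_EFinP; exact: measurable_id.
have split (f : R -> \bar R) : measurable_fun setT f -> (forall x, 0 <= f x) ->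
  \int[P]_(w in A) f (h w) = P A * \int[P]_w f (h w) by exact: ge0_indep_integral.
rewrite funepos_comp funeneg_comp !split//.
- rewrite -muleBr ?fin_num_measure//; apply: fin_num_adde_defl; rewrite fin_numN.
  by have := integrable_neg_fin_num measurableT ih; rewrite funeneg_comp.
- exact: measurable_funeneg.
- exact: measurable_funepos.
Qed.
End IndependentIntegral.

(** * Second moments of sums of independent centered vectors *)

Section SquareIntegrable.
Context {R : realType} {d : measure_display} {Omega : measurableType d}
  (P : probability Omega R) {V : normedModType R}.
Implicit Types (f g : Omega -> V).

Definition square_integrable f :=
  simple_limit f /\ P.-integrable setT (fun w => (`|f w| ^+ 2)%:E).

Lemma measurable_sqr_norm f : simple_limit f ->
  measurable_fun setT (fun w => (`|f w| ^+ 2)%:E).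
Proof.
move=> sf; apply/measurable_EFinP.
by apply: measurable_funX; exact: simple_limit_norm.
Qed.

Lemma square_integrable_lin a f g :
  square_integrable f -> square_integrable g ->
  square_integrable (fun w => a *: f w + g w).
Proof.
move=> [sf f2] [sg g2].
have sfg : simple_limit (fun w => a *: f w + g w) by exact: simple_limit_lin.
split=> //; apply: (@le_integrable _ _ _ _ _ measurableT _
    (fun w => (2 * a ^+ 2)%:E * (`|f w| ^+ 2)%:E + 2%:E * (`|g w| ^+ 2)%:E)%E).
- exact: measurable_sqr_norm.
- move=> w _; rewrite -!EFinM -EFinD !abse_EFin lee_fin.
  rewrite [leLHS]ger0_norm ?sqr_ge0// [leRHS]ger0_norm; last first.
    rewrite addr_ge0 // mulr_ge0 ?sqr_ge0 //.
    by rewrite mulr_ge0 ?sqr_ge0.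
  have h := ler_normD (a *: f w) (g w); rewrite normrZ in h.
  apply: (le_trans (ler_sqr_ge0 (normr_ge0 _) h)).
  rewrite -(real_normK (num_real a)).
  have := sqr_ge0 (`|a| * `|f w| - `|g w|); nra.
- by apply: integrableD => //; apply: integrableZl.
Qed.

Lemma square_integrable0 : square_integrable (cst 0).
Proof.
split; first exact: simple_limit0.
by apply: eq_integrable (integrable0 _ _) => // w _; rewrite /= normr0 expr0n.
Qed.

Lemma square_integrable_sum (I : Type) (r : seq I) (a : I -> R) (F : I -> Omega -> V) :
  (forall i, square_integrable (F i)) ->
  square_integrable (fun w => \sum_(i <- r) a i *: F i w).
Proof.
move=> F2; elim: r => [|i r IHr].
  by under eq_fun do rewrite big_nil; exact: square_integrable0.
by under eq_fun do rewrite big_cons; exact: square_integrable_lin.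
Qed.

Lemma square_integrable_norm f : square_integrable f ->
  P.-integrable setT (fun w => `|f w|%:E).
Proof.
move=> [sf f2].
apply: (@le_integrable _ _ _ _ _ measurableT _
    (fun w => 1%:E + (`|f w| ^+ 2)%:E)%E).
- by apply/measurable_EFinP; exact: simple_limit_norm.
- move=> w _; rewrite -EFinD !abse_EFin lee_fin normr_id ger0_norm; last first.
    by rewrite addr_ge0// sqr_ge0.
  by have := sqr_ge0 (`|f w| - 1); nra.
- by apply: integrableD => //; exact: finite_measure_integrable_cst.
Qed.

Lemma square_integrable_cdual f (phi : cdual V) : square_integrable f ->
  P.-integrable setT (fun w => (phi (f w) : R)%:E).
Proof.
move=> f2; apply: (@le_integrable _ _ _ _ _ measurableT _
    (fun w => `|phi|%:E * `|f w|%:E)%E).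
- apply/measurable_EFinP; apply: (simple_limit_comp f2.1).
  exact: cdual_continuous.
- move=> w _; rewrite -EFinM !abse_EFin lee_fin (le_trans (cdual_le _ _))//.
  exact: ler_norm.
- by apply: integrableZl => //; exact: square_integrable_norm.
Qed.

End SquareIntegrable.

Lemma bigcap_cons (I : choiceType) (T : Type) (i : I) (r : seq I) (F : I -> set T) :
  \bigcap_(j in [set` i :: r]) F j = F i `&` \bigcap_(j in [set` r]) F j.
Proof. by rewrite !bigcap_seq big_cons. Qed.

Section Refinement.
Context {R : realType} {d : measure_display} {Omega : measurableType d}
  (P : {measure set Omega -> \bar R}).
Local Open Scope ereal_scope.

(** An inequality of integrals that holds on each product cell holds globally:
    the partitions indexed by I are summed out one at a time. *)
Lemma ge0_le_integral_refine (C : nat -> nat -> set Omega)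
    (g1 g2 : Omega -> \bar R) (I : seq nat) (A : set Omega) :
  (forall i k, measurable (C i k)) -> (forall i, trivIset setT (C i)) ->
  (forall i w, exists k, C i k w) ->
  measurable_fun setT g1 -> (forall w, 0 <= g1 w) ->
  measurable_fun setT g2 -> (forall w, 0 <= g2 w) ->
  uniq I -> measurable A ->
  (forall kappa : nat -> nat,
    let D := A `&` \bigcap_(i in [set` I]) C i (kappa i) in
    \int[P]_(w in D) g1 w <= \int[P]_(w in D) g2 w) ->
  \int[P]_(w in A) g1 w <= \int[P]_(w in A) g2 w.
Proof.
move=> mC tC cC mg1 g10 mg2 g20.
elim: I A => [|i I IHI] A.
  by move=> _ _ /(_ (fun=> 0%N))/=; rewrite set_nil bigcap_set0 setIT.
move=> /= /andP[iI uI] mA h.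
have AE : A = \bigcup_k (A `&` C i k).
  by apply/seteqP; split=> [w Aw|w [k _ []//]]; have [k Ck] := cC i w; exists k.
have mAC k : measurable (A `&` C i k) by exact: measurableI.
have tAC : trivIset setT (fun k => A `&` C i k) by exact: trivIset_setIl.
rewrite [X in \int[_]_(w in X) g1 w <= _]AE [X in _ <= \int[_]_(w in X) g2 w]AE.
rewrite !ge0_integral_bigcup//; last 2 first.
- exact: measurable_funTS.
- exact: measurable_funTS.
apply: lee_nneseries => [k _ _|k _]; first exact: integral_ge0.
apply: IHI => // kappa /=.
have := h (fun j => if j == i then k else kappa j).
rewrite (_ : A `&` _ = A `&` C i k `&` \bigcap_(j in [set` I]) C j (kappa j))//.
rewrite bigcap_cons setIA eqxx; congr (_ `&` _).
apply: eq_bigcapr => j /= jI; case: eqP => // ji.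
by move: iI; rewrite -ji jI.
Qed.

End Refinement.

Section CellInequality.
Context {R : realType} {V : normedModType R}.

(** The convexity inequality behind jensen_sums, on a cell where U stays close to
    the constant u: |U - W| >= phi (U - W) is about |u| - phi W, and
    r^2 >= 2 m r - m^2. The term linear in phi W integrates to 0; the rest of
    the error has size k. *)
Lemma sqr_norm_cell (u U W : V) (phi : cdual V) (k : R) :
  `|phi| <= 1 -> phi u = `|u| :> R -> 0 <= k -> k <= 1 -> `|U - u| <= k ->
  `|U| ^+ 2 <=
  `|U - W| ^+ 2 + k * (2 * `|U| ^+ 2 + 5) + 2 * `|u| * (phi W : R).
Proof.
move=> phi1 phiu k0 k1 Uu.
have phile v : (phi v : R) <= `|v|.
  apply: (le_trans (ler_norm _)); apply: (le_trans (cdual_le _ _)).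
  by rewrite ler_piMl.
have h1 : `|u| - k - (phi W : R) <= `|U - W|.
  apply: le_trans (phile _); rewrite linearB/= lerD2r -phiu lerBlDr -lerBlDl.
  by rewrite -linearB/= (le_trans (phile _))// distrC.
have h2 : `|U| <= `|u| + k.
  by rewrite -lerBlDl (le_trans _ Uu)// lerB_dist.
have h3 : `|u| <= `|U| + k.
  by rewrite -lerBlDl (le_trans _ Uu)// distrC lerB_dist.
set p := `|U| in h2 h3 *; set m := `|u| in h1 h2 h3 *.
set r := `|U - W| in h1 *; set f : R := phi W in h1 *.
have p0 : 0 <= p by exact: normr_ge0.
have m0 : 0 <= m by exact: normr_ge0.
have a1 : 2 * m * (m - k - f) - m ^+ 2 <= r ^+ 2.
  have : 2 * m * (m - k - f) <= 2 * m * r by rewrite ler_wpM2l// mulr_ge0.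
  by have := sqr_ge0 (r - m); nra.
have a2 : (p - m) * (p + m) <= k * (p + m).
  by apply: ler_wpM2r; [exact: addr_ge0|rewrite lerBlDl].
have a3 : k * (p + 3 * m) <= k * (2 * p ^+ 2 + 5).
  by apply: ler_wpM2l => //; have := sqr_ge0 (p - 1); nra.
nra.
Qed.

End CellInequality.

Section Symmetrization.
Context {R : realType} {d : measure_display} {Omega : measurableType d}
  (P : probability Omega R) {V : normedModType R} (xi : nat -> Omega -> V).
Hypothesis xi_borel : forall i, borel_measurable (xi i).
Hypothesis xi_indep : independent_vectors P xi.
Hypothesis xi2 : forall i, square_integrable P (xi i).
Hypothesis xi_centered : forall i (phi : cdual V),
  (\int[P]_w (phi (xi i w) : R)%:E = 0)%E.

Let S (I : seq nat) w := \sum_(i <- I) xi i w.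

Lemma square_integrable_partial_sum I : square_integrable P (S I).
Proof.
have := square_integrable_sum I (fun=> 1) xi2; rewrite /S.
by under eq_fun do under eq_bigr do rewrite scale1r.
Qed.

Lemma square_integrable_diff I J : square_integrable P (fun w => S I w - S J w).
Proof.
have := square_integrable_lin (-1) (square_integrable_partial_sum J)
  (square_integrable_partial_sum I).
by under eq_fun do rewrite scaleN1r addrC.
Qed.

Lemma indep_centered (I : seq nat) (B : nat -> set V) j (phi : cdual V) :
  uniq I -> j \notin I -> (forall i, borel (B i)) ->
  (\int[P]_(w in \bigcap_(i in [set` I]) xi i @^-1` B i) (phi (xi j w) : R)%:E = 0)%E.
Proof.
move=> uI jI bB.
have mA : measurable (\bigcap_(i in [set` I]) xi i @^-1` B i).
  by rewrite bigcap_seq; apply: bigsetI_measurable => i _; exact: xi_borel.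
rewrite (@indep_integral _ _ _ _ _ (fun w => phi (xi j w)) mA).
- by rewrite xi_centered mule0.
- by apply: (borel_measurable_comp (xi_borel j)); exact: cdual_continuous.
- move=> C mC; pose B' i := if i == j then (phi : V -> R) @^-1` C else B i.
  have bC : borel ((phi : V -> R) @^-1` C).
    by apply: borel_continuous => //; exact: cdual_continuous.
  have bB' i : borel (B' i) by rewrite /B'; case: ifP.
  have B'I i : i \in I -> B' i = B i.
    by rewrite /B'; case: eqP => // ->; rewrite (negbTE jI).
  have := xi_indep (J := j :: I) (B := B'); rewrite /= jI uI => /(_ isT (fun i _ => bB' i)).
  rewrite bigcap_cons big_cons setIC.
  rewrite (eq_bigcapr (fun i iI => congr1 (fun D => xi i @^-1` D) (B'I i iI))).
  rewrite (eq_big_seq (fun i => P (xi i @^-1` B i))); last by move=> i /B'I ->.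
  rewrite -(xi_indep uI (fun i _ => bB i)) {1 2}/B' eqxx => ->.
  by rewrite muleC.
- by apply: (@square_integrable_cdual _ _ _ P); exact: xi2.
Qed.

(** Conditional Jensen inequality E|S_I|^2 <= E|S_I - S_J|^2, obtained without
    conditional expectations: cut Omega into product cells on which every xi_i,
    i in I, is nearly constant, and test against one functional per cell.
    Joint independence of the xi_i suffices, as these cells are intersections of
    events about single xi_i. *)
Lemma jensen_sums (I J : seq nat) : uniq I -> (forall j, j \in J -> j \notin I) ->
  (\int[P]_w (`|S I w| ^+ 2)%:E <= \int[P]_w (`|S I w - S J w| ^+ 2)%:E)%E.
Proof.
move=> uI JI.
have SI2 := square_integrable_partial_sum I.
have SIJ2 := square_integrable_diff I J.
have key (k : R) : 0 < k -> k <= 1 ->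
  (\int[P]_w (`|S I w| ^+ 2)%:E <=
   \int[P]_w (`|S I w - S J w| ^+ 2 +
     k * (2 * `|S I w| ^+ 2 + 5))%:E)%E.
  move=> /[dup] kgt0 /ltW k0 k1.
  (* the errors of the size I terms add up to at most k *)
  pose eta := k / (size I).+1%:R.
  have eta0 : 0 < eta by rewrite divr_gt0.
  have /choice[B /choice[c cells]] i := simple_limit_cells (xi2 i).1 eta0.
  pose g2 w := (`|S I w - S J w| ^+ 2 + k * (2 * `|S I w| ^+ 2 + 5))%:E.
  have ig2 : P.-integrable setT g2.
    have -> : g2 = (fun w => (`|S I w - S J w| ^+ 2)%:E +
        k%:E * (2%:E * (`|S I w| ^+ 2)%:E + 5%:E))%E.
      by apply/funext => w; rewrite /g2 EFinD EFinM EFinD EFinM.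
    apply: integrableD => //; first exact: SIJ2.2.
    apply: integrableZl => //; apply: integrableD => //.
      by apply: integrableZl => //; exact: SI2.2.
    exact: finite_measure_integrable_cst.
  have g2_ge0 w : (0 <= g2 w)%E.
    by rewrite lee_fin addr_ge0 ?sqr_ge0// mulr_ge0// addr_ge0// mulr_ge0// sqr_ge0.
  pose C i n := xi i @^-1` B i n.
  have mC i n : measurable (C i n) by apply: xi_borel; have [] := cells i.
  apply: (@ge0_le_integral_refine _ _ _ P C _ _ I setT) => //.
  - move=> i k1' k2 _ _ [w [Bw1 Bw2]]; have [_ tB _ _] := cells i.
    by apply: tB => //; exists (xi i w).
  - by move=> i w; have [_ _ /(_ w)] := cells i.
  - exact: measurable_sqr_norm SI2.1.
  - exact: measurable_int ig2.
  move=> kappa; rewrite setTI; set A := \bigcap_(i in _) _ => /=.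
  have mA : measurable A.
    by rewrite /A bigcap_seq; exact: bigsetI_measurable.
  pose u := \sum_(i <- I) c i (kappa i).
  have Uu w : A w -> `|S I w - u| <= k.
    move=> Aw; rewrite /S /u -sumrB (le_trans (ler_norm_sum _ _ _))//.
    apply: (@le_trans _ _ (\sum_(i <- I) eta)); last first.
      rewrite big_const_seq count_predT iter_addr_0 -mulr_natl mulrCA.
      by rewrite ler_piMr// ler_pdivrMr// mul1r ler_nat.
    rewrite [leLHS]big_seq [leRHS]big_seq; apply: ler_sum => i iI.
    by have [_ _ _ Bc] := cells i; apply/ltW/(Bc (kappa i))/Aw.
  have [phi phi1 phiu] := norming_functional u.
  have iphi j : P.-integrable A (fun w => (phi (xi j w) : R)%:E).
    apply: (@integrableS _ _ _ _ setT) => //.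
    by apply: (@square_integrable_cdual _ _ _ P); exact: xi2.
  have iphiS : P.-integrable A (fun w => (phi (S J w) : R)%:E).
    apply: (@integrableS _ _ _ _ setT) => //.
    by apply: (@square_integrable_cdual _ _ _ P); exact: square_integrable_partial_sum.
  have phiS0 : (\int[P]_(w in A) (phi (S J w) : R)%:E = 0)%E.
    under eq_integral do rewrite /S linear_sum -sumEFin.
    rewrite integral_sum// big_seq big1// => j jJ.
    by apply: indep_centered => //; [exact: JI|move=> i; have [] := cells i].
  apply: (@le_trans _ _ (\int[P]_(w in A) (g2 w + (2 * `|u|)%:E * (phi (S J w) : R)%:E))%E).
    apply: ge0_le_integral => //.
    - by apply: measurable_funTS; exact: measurable_sqr_norm SI2.1.
    - apply: emeasurable_funD; first by apply: measurable_funTS; exact: measurable_int ig2.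
      by apply: emeasurable_funM => //; exact: measurable_int iphiS.
    - move=> w Aw; rewrite -EFinM -EFinD lee_fin.
      by apply: sqr_norm_cell => //; exact: Uu.
  have ig2A : P.-integrable A g2 by exact: (@integrableS _ _ _ _ setT).
  rewrite integralD//; last exact: integrableZl.
  by rewrite integralZl// phiS0 mule0 adde0.
have [E1 E1E] : exists E1 : R, (\int[P]_w (`|S I w| ^+ 2)%:E = E1%:E)%E.
  by eexists; apply/esym/fineK; exact: integrable_fin_num SI2.2.
have [E2 E2E] : exists E2 : R, (\int[P]_w (`|S I w - S J w| ^+ 2)%:E = E2%:E)%E.
  by eexists; apply/esym/fineK; exact: integrable_fin_num SIJ2.2.
have E10 : 0 <= E1.
  by rewrite -lee_fin -E1E; apply: integral_ge0 => w _; rewrite lee_fin sqr_ge0.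
rewrite E1E E2E lee_fin; apply/ler_addgt0Pr => e e0.
have c0 : 0 < 2 * E1 + 5 by lra.
pose k := Num.min 1 (e / (2 * E1 + 5)).
have kgt0 : 0 < k by rewrite lt_min ltr01 divr_gt0.
have k1 : k <= 1 by rewrite ge_min lexx.
have := key _ kgt0 k1; rewrite E1E.
rewrite (_ : \int[P]_w (_ + _ * _)%:E = \int[P]_w ((`|S I w - S J w| ^+ 2)%:E +
    k%:E * (2%:E * (`|S I w| ^+ 2)%:E + 5%:E)))%E; last first.
  by apply: eq_integral => w _; rewrite EFinD EFinM EFinD EFinM.
have i1 : P.-integrable setT (fun w => 2%:E * (`|S I w| ^+ 2)%:E)%E.
  by apply: integrableZl => //; exact: SI2.2.
have i2 : P.-integrable setT (fun w => 2%:E * (`|S I w| ^+ 2)%:E + 5%:E)%E.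
  by apply: integrableD => //; exact: finite_measure_integrable_cst.
rewrite integralD//; [|exact: SIJ2.2|exact: integrableZl].
rewrite E2E integralZl// integralD//; last exact: finite_measure_integrable_cst.
rewrite integralZl//; last exact: SI2.2.
have -> : (\int[P]_(w in setT) 5%:E = 5%:E)%E.
  transitivity (5%:E * P setT)%E; first exact: integral_cst.
  by rewrite probability_setT mule1.
rewrite E1E.
move=> E12; have {E12} : (E1%:E <= (E2 + k * (2 * E1 + 5))%:E)%E by exact: E12.
rewrite lee_fin => /le_trans; apply.
rewrite lerD2l; apply: (@le_trans _ _ (e / (2 * E1 + 5) * (2 * E1 + 5))).
  by rewrite ler_wpM2r ?(ltW c0)// ge_min lexx orbT.
by rewrite divfK ?gt_eqF.
Qed.

(** Split the terms according to their sign into S_I and S_J. Then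
    |S_I + S_J|^2 <= 2 |S_I|^2 + 2 |S_J|^2, and both squares are dominated in
    mean by |S_I - S_J|^2. *)
Lemma symmetrization (N : nat) (s : nat -> bool) :
  (\int[P]_w (`|\sum_(i < N) xi i w| ^+ 2)%:E <=
   4%:E * \int[P]_w (`|\sum_(i < N) (-1) ^+ s i *: xi i w| ^+ 2)%:E)%E.
Proof.
pose I := [seq i <- iota 0 N | ~~ s i]; pose J := [seq i <- iota 0 N | s i].
have uI : uniq I by rewrite filter_uniq// iota_uniq.
have uJ : uniq J by rewrite filter_uniq// iota_uniq.
have JI j : j \in J -> j \notin I.
  by rewrite !mem_filter => /andP[-> _].
have IJ i : i \in I -> i \notin J.
  by rewrite !mem_filter => /andP[/negPf-> _].
have sumE w : \sum_(i < N) xi i w = S I w + S J w.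
  rewrite -(big_mkord xpredT (fun i => xi i w)) /S !big_filter /index_iota subn0.
  by rewrite (bigID s) addrC.
have sumsE w : \sum_(i < N) (-1) ^+ s i *: xi i w = S I w - S J w.
  rewrite -(big_mkord xpredT (fun i => (-1) ^+ s i *: xi i w)) /S !big_filter.
  rewrite /index_iota subn0 (bigID s) addrC /= -sumrN; congr (_ + _).
      by apply: eq_bigr => i ->; rewrite scaleN1r.
  by apply: eq_bigr => i /negPf->; rewrite scale1r.
have h1 := jensen_sums uI JI.
have h2 := jensen_sums uJ IJ.
rewrite (eq_integral (fun w => (`|S I w + S J w| ^+ 2)%:E)); last first.
  by move=> w _; rewrite sumE.
rewrite [in leRHS](eq_integral (fun w => (`|S I w - S J w| ^+ 2)%:E)); last first.
  by move=> w _; rewrite sumsE.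
have h2' : (\int[P]_w (`|S J w| ^+ 2)%:E <= \int[P]_w (`|S I w - S J w| ^+ 2)%:E)%E.
  apply: (le_trans h2); rewrite le_eqVlt; apply/orP; left; apply/eqP.
  by apply: eq_integral => w _; rewrite distrC.
have iI : P.-integrable setT (fun w => 2%:E * (`|S I w| ^+ 2)%:E)%E.
  by apply: integrableZl => //; exact: (square_integrable_partial_sum I).2.
have iJ : P.-integrable setT (fun w => 2%:E * (`|S J w| ^+ 2)%:E)%E.
  by apply: integrableZl => //; exact: (square_integrable_partial_sum J).2.
have mI := measurable_sqr_norm (square_integrable_partial_sum I).1.
have mJ := measurable_sqr_norm (square_integrable_partial_sum J).1.
apply: (@le_trans _ _ (\int[P]_w
    (2%:E * (`|S I w| ^+ 2)%:E + 2%:E * (`|S J w| ^+ 2)%:E))%E).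
  apply: ge0_le_integral => //.
  - have := square_integrable_lin 1 (square_integrable_partial_sum I)
      (square_integrable_partial_sum J).
    by under eq_fun do rewrite scale1r; move=> [/measurable_sqr_norm].
  - by apply: emeasurable_funD; [exact: measurable_int iI|exact: measurable_int iJ].
  - move=> w _; rewrite -!EFinM -EFinD lee_fin.
    apply: (le_trans (ler_sqr_ge0 (normr_ge0 _) (ler_normD _ _))).
    by have := sqr_ge0 (`|S I w| - `|S J w|); nra.
rewrite integralD// !integralZl//; last 2 first.
- exact: (square_integrable_partial_sum J).2.
- exact: (square_integrable_partial_sum I).2.
set E := (\int[P]_w (`|S I w - S J w| ^+ 2)%:E)%E in h1 h2' *.
rewrite (_ : 4%:E = 2%:E + 2%:E)%E; last by rewrite -EFinD -natrD.
by rewrite ge0_muleDl// leeD// lee_wpmul2l.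
Qed.

(** Average the symmetrization inequality over a good family of sign patterns. The
    hypothesis on the values of xi says that, at each point, they span an
    isometric copy of a subspace of X, so that the inequality for X applies. *)
Lemma second_moment_partial_sum (X : normedModType R) (N : nat) (c M : R) :
  0 <= c ->
  sign_type X N c ->
  (forall w, exists x : nat -> X, forall n (a : nat -> R),
    `|\sum_(i < n) a i *: xi i w| = `|\sum_(i < n) a i *: x i|) ->
  (forall i, \int[P]_w (`|xi i w| ^+ 2)%:E <= M%:E)%E ->
  (\int[P]_w (`|\sum_(i < N) xi i w| ^+ 2)%:E <= (4 * c * N%:R * M)%:E)%E.
Proof.
move=> c0 [T [s [T0 sP]]] xiX xiM.
have K0 : 0 < #|T|%:R :> R by rewrite ltr0n.
have SN2 (a : nat -> R) : square_integrable P (fun w => \sum_(i < N) a i *: xi i w).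
  by apply: square_integrable_sum => i; exact: xi2.
have [e eE] : exists e : R, (\int[P]_w (`|\sum_(i < N) xi i w| ^+ 2)%:E = e%:E)%E.
  eexists; apply/esym/fineK; have := integrable_fin_num measurableT (SN2 (fun=> 1)).2.
  by under eq_integral do under eq_bigr do rewrite scale1r.
rewrite eE lee_fin -(ler_pM2l K0) -(lee_fin (_ * e)).
have -> : (#|T|%:R * e)%:E = (\sum_(t : T) e%:E)%E.
  by rewrite sumEFin sumr_const mulr_natl.
have sym t : (e%:E <= 4%:E *
    \int[P]_w (`|\sum_(i < N) (-1) ^+ s t i *: xi i w| ^+ 2)%:E)%E.
  by rewrite -eE; exact: symmetrization.
apply: (le_trans (lee_sum _ (fun t _ => sym t))).
rewrite -ge0_sume_distrr; last first.
  by move=> t _; apply: integral_ge0 => w _; rewrite lee_fin sqr_ge0.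
have mt (t : T) : measurable_fun setT
    (fun w => (`|\sum_(i < N) (-1) ^+ s t i *: xi i w| ^+ 2)%:E).
  exact: (measurable_sqr_norm (SN2 (fun i => (-1) ^+ s t i)).1).
rewrite -ge0_integral_sum//.
pose Q w := (\sum_(i < N) (`|xi i w| ^+ 2)%:E)%E.
have mQ : measurable_fun setT Q.
  by apply: emeasurable_sum => i; exact: measurable_sqr_norm (xi2 i).1.
have Q0 w : (0 <= Q w)%E by apply: sume_ge0 => i _; rewrite lee_fin sqr_ge0.
have Kc0 : 0 <= #|T|%:R * c by rewrite mulr_ge0.
apply: (@le_trans _ _ (4%:E * \int[P]_w ((#|T|%:R * c)%:E * Q w))%E).
  apply: lee_wpmul2l => //; apply: ge0_le_integral => //.
  - by move=> w _; apply: sume_ge0 => t _; rewrite lee_fin sqr_ge0.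
  - exact: emeasurable_sum.
  - by apply: emeasurable_funM.
  - move=> w _; rewrite /Q !sumEFin -EFinM lee_fin.
    have [x xE] := xiX w.
    have xi1 i : `|xi i w| = `|x i|.
      have := xE i.+1 (fun j => (j == i)%:R); rewrite !big_ord_recr /= eqxx !scale1r.
      rewrite !big1 ?add0r// => j _; rewrite (_ : (j : nat) == i = false) ?scale0r//.
        by apply/negbTE; rewrite neq_ltn ltn_ord.
      by apply/negbTE; rewrite neq_ltn ltn_ord.
    under eq_bigr do rewrite (xE N (fun i => (-1) ^+ s _ i)).
    under [in leRHS]eq_bigr do rewrite xi1.
    exact: sP.
rewrite ge0_integralZl_EFin//.
rewrite ge0_integral_sum//; last first.
  by move=> i; exact: measurable_sqr_norm (xi2 i).1.
apply: (@le_trans _ _ (4%:E * ((#|T|%:R * c)%:E * \sum_(i < N) M%:E))%E).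
  by apply: lee_wpmul2l => //; apply: lee_wpmul2l => //; apply: lee_sum => i _.
rewrite sumEFin sumr_const card_ord -[M *+ N]mulr_natl.
by rewrite -!EFinM lee_fin le_eqVlt; apply/orP; left; apply/eqP; ring.
Qed.

End Symmetrization.

(** * The strong law from a rate of decay of second moments *)

Section RealSequences.
Context {R : realType}.

Lemma sqr_sum_le (I : Type) (r : seq I) (F : I -> R) :
  (\sum_(i <- r) F i) ^+ 2 <= (size r)%:R * \sum_(i <- r) F i ^+ 2.
Proof.
elim: r => [|i r IHr]; first by rewrite !big_nil expr0n mul0r.
rewrite !big_cons /=; have [r0|r0] := posnP (size r).
  by rewrite (size0nil r0) !big_nil !addr0 mul1r.
set S := \sum_(j <- r) F j in IHr *; set Q := \sum_(j <- r) F j ^+ 2 in IHr *.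
have n0 : 0 < (size r)%:R :> R by rewrite ltr0n.
rewrite -natr1; set n := (size r)%:R in IHr n0 *.
have h : 0 <= n * (n * F i ^+ 2 + Q - 2 * F i * S).
  by have := sqr_ge0 (n * F i - S); nra.
by rewrite pmulr_rge0// in h; nra.
Qed.

(** Compare with the telescoping series of 2 / (k+1) - 2 / (k+2). *)
Lemma sum_inv_sqr_le (n : nat) :
  \sum_(k < n) (k.+1%:R ^- 2 : R) <= 2 - 2 / n.+1%:R.
Proof.
elim: n => [|n IHn]; first by rewrite big_ord0 divr1 subrr.
rewrite big_ord_recr /=; apply: (le_trans (lerD IHn (lexx _))).
rewrite -[n.+2%:R]natr1 -[n.+1%:R]natr1; have : 0 <= n%:R :> R by [].
move: (n%:R : R) => x x0; rewrite -subr_ge0.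
have -> : 2 - 2 / (x + 1 + 1) - (2 - 2 / (x + 1) + (x + 1) ^- 2) =
    x / ((x + 1) ^+ 2 * (x + 2)).
  by field; apply/andP; split; rewrite gt_eqF//; lra.
by rewrite divr_ge0// mulr_ge0 ?sqr_ge0//; lra.
Qed.

(** Discrete form of (b^a)' = a * b^(a-1); the factor 2^a absorbs the passage
    from b + 1 to b. *)
Lemma power_gap_le (b : R) (a : nat) : 1 <= b ->
  ((b + 1) ^+ a - b ^+ a) * b <= a%:R * 2 ^+ a * b ^+ a.
Proof.
move=> b1; elim: a => [|a IHa]; first by rewrite !expr0 subrr !mul0r.
have p0 : 0 <= b ^+ a by rewrite exprn_ge0//; lra.
have q1 : 1 <= 2 ^+ a :> R by rewrite exprn_ege1//; lra.
have a0 : 0 <= a%:R :> R by [].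
rewrite !exprS -natr1; move: (b ^+ a) ((b + 1) ^+ a) (2 ^+ a) (a%:R : R) IHa p0 q1 a0.
move=> p q s t IHa p0 s1 t0.
have h1 : (b + 1) * ((q - p) * b) <= (b + 1) * (t * s * p).
  by rewrite ler_wpM2l//; lra.
have h2 : 0 <= (b - 1) * (t * s * p).
  by rewrite !mulr_ge0//; lra.
have h3 : 0 <= b * p * (2 * s - 1).
  by rewrite !mulr_ge0//; lra.
nra.
Qed.

(** For (k+1)^a <= n + 1 < (k+2)^a the partial sum up to n differs from the one
    up to (k+1)^a by at most the sum of the norms over the whole block. *)
Lemma cvg_averages_of_blocks (V : normedModType R) (u : nat -> V) (a : nat) :
  (0 < a)%N ->
  ((`|\sum_(i < k.+1 ^ a) u i| + \sum_(k.+1 ^ a <= i < k.+2 ^ a) `|u i|) /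
    k.+1%:R ^+ a) ^+ 2 @[k --> \oo] --> (0 : R) ->
  n.+1%:R^-1 * `|\sum_(i < n.+1) u i| @[n --> \oo] --> (0 : R).
Proof.
move=> a0 tcvg; apply/cvgr0Pnorm_le => e e0.
have /cvgr0_norm_le /(_ (e ^+ 2)) := tcvg; rewrite exprn_gt0// => /(_ isT)[K _ tK].
exists (K.+1 ^ a)%N => // n /= Kn.
have Kn1 : (K.+1 ^ a <= n.+1)%N by exact: leqW.
have ubk k : (k.+1 ^ a <= n.+1)%N -> (k <= n)%N.
  by move=> h; rewrite -ltnS (leq_trans _ h)// -{1}(expn1 k.+1) leq_pexp2l.
pose Q k := (k.+1 ^ a <= n.+1)%N.
have [k Qk kmax] := ex_maxnP (ex_intro Q K Kn1) ubk.
have nk : (n.+1 < k.+2 ^ a)%N.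
  by rewrite ltnNge; apply/negP => /(kmax k.+1); rewrite ltnn.
have Kk : (K <= k)%N by exact: kmax.
have b0 : 0 < k.+1%:R ^+ a :> R by rewrite exprn_gt0.
have := tK _ Kk; rewrite normrX ler_pXn2r ?nnegrE// ?(ltW e0)//.
set t := (_ / _) => te.
rewrite normrM normfV normr_id ger0_norm// (le_trans _ te)// /t.
rewrite normrM normfV (ger0_norm (ltW b0)) mulrC; apply: ler_pM => //.
  rewrite (le_trans _ (ler_norm _))// -[X in `|X|](big_mkord xpredT u).
  rewrite (big_cat_nat (leq0n _) Qk)/= big_mkord (le_trans (ler_normD _ _))// lerD2l.
  rewrite (le_trans (ler_norm_sum _ _ _))//.
  by rewrite [leRHS](big_cat_nat Qk (ltnW nk))/= lerDl sumr_ge0.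
by rewrite lef_pV2 ?posrE// -natrX ler_nat.
Qed.

End RealSequences.

Section SummableMoments.
Context {R : realType} {d : measure_display} {Omega : measurableType d}
  (P : probability Omega R).

(** The series of the Y k has finite expectation, hence converges almost
    surely. *)
Lemma ae_cvg0_of_moments (Y : nat -> Omega -> R) (C : R) :
  (forall k, measurable_fun setT (Y k)) -> (forall k w, 0 <= Y k w) ->
  (forall k, \int[P]_w (Y k w)%:E <= (C * k.+1%:R ^- 2)%:E)%E ->
  {ae P, forall w, Y k w @[k --> \oo] --> (0 : R)}.
Proof.
move=> mY Y0 YC.
have YE0 k w : (0 <= (Y k w)%:E)%E by rewrite lee_fin Y0.
have C0 : 0 <= C.
  have : (0 <= \int[P]_w (Y 0%N w)%:E)%E by apply: integral_ge0 => w _; exact: YE0.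
  by move=> /le_trans /(_ (YC 0%N)); rewrite expr1n invr1 mulr1 lee_fin.
have mYE k : measurable_fun setT (fun w => (Y k w)%:E) by exact/measurable_EFinP.
pose F w := (\sum_(k <oo) (Y k w)%:E)%E.
have F0 w : (0 <= F w)%E by apply: nneseries_ge0 => k _ _; exact: YE0.
have mF : measurable_fun setT F.
  by apply: ge0_emeasurable_sum => // k w _ _; exact: YE0.
have intF : P.-integrable setT F.
  apply/integrableP; split=> //.
  under eq_integral do rewrite gee0_abs//.
  rewrite integral_nneseries//.
  apply: (@le_lt_trans _ _ (C * 2)%:E); last exact: ltry.
  apply: lime_le.
    by apply: is_cvg_nneseries => k _ _; apply: integral_ge0 => w _; exact: YE0.
  apply: nearW => n; apply: (@le_trans _ _ (\sum_(0 <= k < n) (C * k.+1%:R ^- 2)%:E)%E).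
    exact: lee_sum.
  rewrite sumEFin lee_fin -mulr_sumr ler_wpM2l// big_mkord.
  by apply: (le_trans (sum_inv_sqr_le n)); rewrite gerBl.
apply: filterS (integrable_ae measurableT intF) => w /(_ Logic.I) Fw.
apply: cvg_series_cvg_0; apply: nondecreasing_is_cvgn.
  apply/nondecreasing_seqP => n; rewrite /series /= big_nat_recr//= lerDl.
  exact: Y0.
exists (fine (F w)) => _ [n _ <-]; rewrite -lee_fin fineK// /series /= -sumEFin.
by apply: nneseries_lim_ge => k _ _; exact: YE0.
Qed.

End SummableMoments.

Section StrongLaw.
Context {R : realType} {d : measure_display} {Omega : measurableType d}
  (P : probability Omega R) {V : normedModType R} (xi : nat -> Omega -> V).

(** The block lengths are O((k+1)^(a-1)), so by Cauchy-Schwarz the blocks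
    contribute O(1/k^2) in mean square for any a; the rate assumed on the
    partial sums at the times (k+1)^a gives the same order. *)
Lemma slln_of_moments (a : nat) (C M : R) :
  (0 < a)%N -> (forall i, square_integrable P (xi i)) ->
  (forall i, \int[P]_w (`|xi i w| ^+ 2)%:E <= M%:E)%E ->
  (forall k, \int[P]_w (`|\sum_(i < k.+1 ^ a) xi i w| ^+ 2)%:E <=
    (C * (k.+1%:R ^+ a) ^+ 2 / k.+1%:R ^+ 2)%:E)%E ->
  {ae P, forall w,
    n.+1%:R^-1 * `|\sum_(i < n.+1) xi i w| @[n --> \oo] --> (0 : R)}.
Proof.
move=> a0 xi2 xiM SC.
pose gap k w := \sum_(k.+1 ^ a <= i < k.+2 ^ a) `|xi i w|.
pose t k w := ((`|\sum_(i < k.+1 ^ a) xi i w| + gap k w) / k.+1%:R ^+ a) ^+ 2.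
have M0 : 0 <= M.
  have : (0 <= \int[P]_w (`|xi 0%N w| ^+ 2)%:E)%E.
    by apply: integral_ge0 => w _; rewrite lee_fin sqr_ge0.
  by move=> /le_trans /(_ (xiM 0%N)); rewrite lee_fin.
have S2 k : square_integrable P (fun w => \sum_(i < k.+1 ^ a) xi i w).
  have := square_integrable_sum (index_enum 'I_(k.+1 ^ a)) (fun=> 1) (fun i => xi2 i).
  by under eq_fun do under eq_bigr do rewrite scale1r.
pose K : R := a%:R * 2 ^+ a.
suff tae : {ae P, forall w, t k w @[k --> \oo] --> (0 : R)}.
  by apply: filterS tae => w; exact: cvg_averages_of_blocks.
have mt k : measurable_fun setT (t k).
  apply: measurable_funX; apply: measurable_funM => //.
  apply: measurable_funD; first exact: simple_limit_norm (S2 k).1.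
  by apply: measurable_sum => i; exact: simple_limit_norm (xi2 i).1.
apply: (@ae_cvg0_of_moments _ _ _ _ _ (2 * C + 2 * K ^+ 2 * M)) => //.
  by move=> k w; rewrite sqr_ge0.
move=> k; pose b : R := k.+1%:R ^+ a.
have b0 : 0 < b by rewrite exprn_gt0.
pose g : R := (k.+2 ^ a - k.+1 ^ a)%:R.
have g0 : 0 <= g by [].
have gle : g <= K * b / k.+1%:R.
  rewrite ler_pdivlMr// /g natrB ?leq_exp2r// !natrX -[k.+2%:R]natr1.
  by apply: power_gap_le; rewrite ler1n.
pose Q w := \sum_(k.+1 ^ a <= i < k.+2 ^ a) `|xi i w| ^+ 2.
have pt w : t k w <= 2 * b ^- 2 * `|\sum_(i < k.+1 ^ a) xi i w| ^+ 2 +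
    2 * b ^- 2 * g * Q w.
  rewrite /t -/b expr_div_n mulrC -[2 * b ^- 2]mulrC -!mulrA -mulrDr.
  rewrite ler_wpM2l ?invr_ge0 ?sqr_ge0//.
  have gQ : gap k w ^+ 2 <= g * Q w.
    by rewrite /gap /Q (le_trans (sqr_sum_le _ _))// size_iota.
  have := sqr_ge0 (`|\sum_(i < k.+1 ^ a) xi i w| - gap k w); nra.
have mS := measurable_sqr_norm (S2 k).1.
have mxi i := measurable_sqr_norm (xi2 i).1.
pose QE w := (\sum_(k.+1 ^ a <= i < k.+2 ^ a) (`|xi i w| ^+ 2)%:E)%E.
have QE0 w : (0 <= QE w)%E by apply: sume_ge0 => i _; rewrite lee_fin sqr_ge0.
have mQ : measurable_fun setT QE by exact: emeasurable_sum.
have c0 : 0 <= 2 * b ^- 2 by rewrite mulr_ge0// invr_ge0 sqr_ge0.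
have cg0 : 0 <= 2 * b ^- 2 * g by rewrite mulr_ge0.
apply: (@le_trans _ _ (\int[P]_w
    ((2 * b ^- 2)%:E * (`|\sum_(i < k.+1 ^ a) xi i w| ^+ 2)%:E +
     (2 * b ^- 2 * g)%:E * QE w))%E).
  apply: ge0_le_integral => //.
  - by move=> w _; rewrite lee_fin sqr_ge0.
  - apply/measurable_EFinP; exact: mt.
  - by apply: emeasurable_funD; apply: emeasurable_funM.
  - by move=> w _; rewrite /QE sumEFin -!EFinM -EFinD lee_fin; exact: pt.
rewrite ge0_integralD//; last 4 first.
- by move=> w _; rewrite mule_ge0// lee_fin sqr_ge0.
- by apply: emeasurable_funM.
- by move=> w _; rewrite mule_ge0.
- by apply: emeasurable_funM.
rewrite !ge0_integralZl_EFin//.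
rewrite ge0_integral_sum//.
have sM : (\sum_(k.+1 ^ a <= i < k.+2 ^ a) \int[P]_w (`|xi i w| ^+ 2)%:E <=
    (g * M)%:E)%E.
  apply: (@le_trans _ _ (\sum_(k.+1 ^ a <= i < k.+2 ^ a) M%:E)%E).
    by apply: lee_sum => i _; exact: xiM.
  rewrite sumEFin lee_fin big_const_seq count_predT size_iota iter_addr_0.
  by rewrite -mulr_natl.
apply: (@le_trans _ _ (2 * b ^- 2 * (C * b ^+ 2 / k.+1%:R ^+ 2) +
    2 * b ^- 2 * g * (g * M))%:E).
  rewrite [leRHS]EFinD; apply: leeD; rewrite [leRHS]EFinM.
    by apply: lee_wpmul2l => //; exact: SC.
  exact: lee_wpmul2l.
rewrite lee_fin.
rewrite [leRHS]mulrDl; apply: lerD.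
  by rewrite le_eqVlt; apply/orP; left; apply/eqP; field; rewrite !gt_eqF.
rewrite (_ : 2 * b ^- 2 * g * (g * M) = 2 * b ^- 2 * M * g ^+ 2); last by ring.
apply: (@le_trans _ _ (2 * b ^- 2 * M * (K * b / k.+1%:R) ^+ 2)).
  by apply: ler_wpM2l; [rewrite mulr_ge0|apply: ler_sqr_ge0].
by rewrite le_eqVlt; apply/orP; left; apply/eqP; field; rewrite !gt_eqF.
Qed.

End StrongLaw.

Section BeckLaw.
Context {R : realType} {d : measure_display} {Omega : measurableType d}
  (P : probability Omega R) {X V : normedModType R} (xi : nat -> Omega -> V).

(** Beck's strong law of large numbers: the mean-square rate provided by
    B-convexity is the one that slln_of_moments asks for. *)
Lemma b_convex_slln (M : R) : b_convex X ->
  (forall i, borel_measurable (xi i)) ->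
  independent_vectors P xi ->
  (forall i, square_integrable P (xi i)) ->
  (forall i (phi : cdual V), \int[P]_w (phi (xi i w) : R)%:E = 0)%E ->
  (forall w, exists x : nat -> X, forall n (a : nat -> R),
    `|\sum_(i < n) a i *: xi i w| = `|\sum_(i < n) a i *: x i|) ->
  (forall i, \int[P]_w (`|xi i w| ^+ 2)%:E <= M%:E)%E ->
  {ae P, forall w,
    n.+1%:R^-1 * `|\sum_(i < n.+1) xi i w| @[n --> \oo] --> (0 : R)}.
Proof.
move=> BX bxi indep xi2 xi0 xiX xiM.
have M0 : 0 <= M.
  have : (0 <= \int[P]_w (`|xi 0%N w| ^+ 2)%:E)%E.
    by apply: integral_ge0 => w _; rewrite lee_fin sqr_ge0.
  by move=> /le_trans /(_ (xiM 0%N)); rewrite lee_fin.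
have [a [C [a0 C0 rate]]] := b_convex_growth_rate BX.
apply: (@slln_of_moments _ _ _ _ _ _ a (4 * C * M) M) => // k.
have [c [c0 cT cC]] := rate k.
have := second_moment_partial_sum bxi indep xi2 xi0 c0 cT xiX xiM.
move=> /le_trans; apply; rewrite lee_fin natrX.
rewrite (_ : 4 * C * M * _ / _ = 4 * (C * k.+1%:R ^+ a / k.+1%:R ^+ 2) *
  k.+1%:R ^+ a * M); last by ring.
by rewrite ler_wpM2r// ler_wpM2r ?exprn_ge0// ler_wpM2l.
Qed.

End BeckLaw.

(** * Weak means and null sets *)

Section WeakMean.
Context {R : realType} {d : measure_display} {Omega : measurableType d}
  (P : probability Omega R) {V : normedModType R}.

Lemma integral_cdual_vsimple (s : Omega -> V) (phi : cdual V) : vsimple s ->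
  P.-integrable setT (fun w => (phi (s w) : R)%:E) /\
  (\int[P]_w (phi (s w) : R)%:E = (phi (vsimple_integral P s) : R)%:E)%E.
Proof.
move=> [fs ms]; rewrite /vsimple_integral fsbig_finite//=.
pose r := finmap.enum_fset (fset_set (range s)).
pose h (v : V) w := ((phi v : R)%:E * (\1_(s @^-1` [set v]) w)%:E)%E.
have sE w : (phi (s w) : R)%:E = (\sum_(v <- r) h v w)%E.
  have sr : s w \in r by rewrite /r in_fset_set // inE; exists w.
  have ur : uniq r by rewrite /r finmap.fset_uniq.
  rewrite (bigD1_seq (s w))//= big1 ?adde0 => [|v vs].
    by rewrite /h indicE mem_set// mule1.
  by rewrite /h indicE memNset ?mule0// => /= sv; rewrite sv eqxx in vs.
have ih v : P.-integrable setT (h v).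
  by apply: integrableZl => //; apply: integrable_indic.
rewrite (_ : (fun w => _) = (fun w => (\sum_(v <- r) h v w)%E)); last exact/funext.
split; first exact: integrable_sum.
rewrite integral_sum// linear_sum -sumEFin; apply: eq_bigr => v _.
rewrite /h integralZl//; last exact: integrable_indic.
rewrite integral_indic// setIT linearZ/= EFinM muleC fineK//.
exact: fin_num_measure.
Qed.

Lemma vsimple_sub_measurable (f s : Omega -> V) :
  borel_measurable f -> vsimple s -> measurable_fun setT (fun w => `|f w - s w|).
Proof.
move=> bf vs _ B mB; rewrite setTI.
rewrite (_ : _ @^-1` _ = \bigcup_(v in range s)
    (s @^-1` [set v] `&` f @^-1` ((fun u => `|u - v|) @^-1` B))).
  apply: fin_bigcup_measurable => [|v _]; first exact: vs.1.
  apply: measurableI; first exact: vs.2.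
  apply: bf; apply: borel_continuous => // u.
  by apply: cvg_norm; apply: cvgB => //; exact: cvg_cst.
by apply/seteqP; split=> [w /= Bw|w [v _ [/= -> //]]]; exists (s w) => //; exists w.
Qed.

(** A continuous functional commutes with the integral of simple functions, and
    both sides are continuous for the L1 distance. *)
Lemma bochner_integral_cdual (f : Omega -> V) (v : V) (phi : cdual V) :
  borel_measurable f -> P.-integrable setT (fun w => (phi (f w) : R)%:E) ->
  bochner_integral_is P f v ->
  (\int[P]_w (phi (f w) : R)%:E = (phi v : R)%:E)%E.
Proof.
move=> bf iphi [s [vs sf] sv].
have [I IE] : exists I : R, (\int[P]_w (phi (f w) : R)%:E = I%:E)%E.
  by eexists; apply/esym/fineK; exact: integrable_fin_num iphi.
rewrite IE; congr EFin.
have phis : (phi (vsimple_integral P (s k)) : R) @[k --> \oo] --> (phi v : R).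
  by apply: (cvg_comp _ _ sv); exact: cdual_continuous.
apply/esym/(cvg_unique _ phis) => //.
have [sfin s0] := (fine_cvgP _ _).1 sf.
apply/cvgrPdist_le => e e0.
have phi1 : 0 < `|phi| + 1 by rewrite ltr_wpDl.
near=> k.
have kfin : (\int[P]_w (`|f w - s k w|)%:E)%E \is a fin_num by near: k.
have ke : fine (\int[P]_w (`|f w - s k w|)%:E)%E <= e / (`|phi| + 1).
  rewrite -[leLHS]subr0; apply: (le_trans (ler_norm _)); rewrite distrC.
  by near: k; move/cvgrPdist_le : s0; apply; rewrite divr_gt0.
have [iphis intphis] := integral_cdual_vsimple phi (vs k).
rewrite -lee_fin -abse_EFin EFinB -IE -intphis -integralB//.
have ms := vsimple_sub_measurable bf (vs k).
have mB := measurable_int _ (integrableB measurableT iphi iphis).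
apply: (le_trans (le_abse_integral _ _ mB)) => //.
apply: (@le_trans _ _ (\int[P]_w ((`|phi| + 1)%:E * (`|f w - s k w|)%:E))%E).
  apply: ge0_le_integral => //.
  - exact: measurableT_comp.
  - by apply: emeasurable_funM => //; exact/measurable_EFinP.
  - move=> w _; rewrite -EFinB -EFinM abse_EFin lee_fin -linearB.
    by rewrite (le_trans (cdual_le _ _))// ler_wpM2r// lerDl.
rewrite ge0_integralZl_EFin//; last exact/measurable_EFinP.
by rewrite -(fineK kfin) -EFinM lee_fin mulrC -ler_pdivlMr.
Unshelve. all: by end_near. Qed.

End WeakMean.

Section NullSets.
Context {R : realType} {d : measure_display} {Omega : measurableType d}
  (P : probability Omega R) {V : normedModType R}.

(** The exceptional null set can be chosen independent of i. For each value v of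
    the approximating simple functions and each m pick one index witnessing
    |q i v| > 1/(m+1), if there is one. These countably many indices suffice:
    if some q i (f w) is nonzero, then q i (s k w) is large for s k w close to
    f w, so q at the index picked for s k w is nonzero at f w as well. *)
Lemma ae_forall_equilipschitz (I : Type) (q : I -> V -> R) (f : Omega -> V) :
  (forall i u v, `|q i u - q i v| <= 2 * `|u - v|) ->
  strongly_measurable P f ->
  (forall i, {ae P, forall w, q i (f w) = 0}) ->
  {ae P, forall w, forall i, q i (f w) = 0}.
Proof.
move=> qlip [s vs sf] q0.
have /choice[r rE] k : exists r : seq V, range (s k) = [set` r].
  exact/finite_seqP/(vs k).1.
have sel_ex (vm : V * nat) : exists o : option I,
    forall i, vm.2.+1%:R^-1 < `|q i vm.1| ->
      if o is Some i' then vm.2.+1%:R^-1 < `|q i' vm.1| else false.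
  have [[i qi]|nqi] := pselect (exists i, vm.2.+1%:R^-1 < `|q i vm.1|).
    by exists (Some i).
  by exists None => i qi; case: nqi; exists i.
have [sel selP] := choice sel_ex.
have ae_sel : {ae P, forall w, forall k n m,
    if sel (nth 0 (r k) n, m) is Some i then q i (f w) = 0 else True}.
  apply: ae_foralln => k; apply: ae_foralln => n; apply: ae_foralln => m.
  by case: (sel _) => [i|]; [exact: q0|exact: aeW].
apply: filterS2 sf ae_sel => w sfw selw i; apply/eqP/negPn/negP => qi0.
have q_gt0 : 0 < `|q i (f w)| / 2 by rewrite divr_gt0// normr_gt0.
have [m qm] : exists m, m.+1%:R^-1 < `|q i (f w)| / 2.
  by have [m] := ltr_add_invr q_gt0; rewrite add0r; exists m.
have e0 : 0 < m.+1%:R^-1 / 2 :> R by rewrite divr_gt0// invr_gt0.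
have /cvgr_dist_lt /(_ _ e0) [k _ /(_ k (leqnn k)) /= fk] := sfw.
have lip j := qlip j (f w) (s k w).
have qik : m.+1%:R^-1 < `|q i (s k w)|.
  move: (lerB_dist (q i (f w)) (q i (s k w))) (lip i) fk qm.
  by move: (m.+1%:R^-1 : R) => t; lra.
have /nthP-/(_ 0)[n _ nE] : s k w \in r k.
  by have : [set` r k] (s k w) by rewrite -rE; exists w.
have := selw k n m; rewrite nE; have := selP (s k w, m) i qik => /=.
case: (sel _) => // i' qi' q0'; move: qi' (lip i') fk.
by rewrite q0' sub0r normrN; move: (m.+1%:R^-1 : R) => t; lra.
Qed.

Definition zero_on (A : set Omega) (f : Omega -> V) w := if w \in A then 0 else f w.

Lemma preimage_zero_on A f (B : set V) :
  zero_on A f @^-1` B = (A `&` [set _ | B 0]) `|` (~` A `&` f @^-1` B).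
Proof.
apply/seteqP; split=> w /=; rewrite /zero_on.
  by case: ifPn => [/set_mem ?|/negP nA] ?; [left|right; split=> // /mem_set].
by move=> [[/mem_set-> ]//|[nA]]; case: ifPn => // /set_mem.
Qed.

Lemma measurable_zero_on A f (B : set V) : measurable A -> measurable (f @^-1` B) ->
  measurable (zero_on A f @^-1` B).
Proof.
move=> mA mf; rewrite preimage_zero_on; apply: measurableU.
  apply: measurableI => //; have [B0|nB0] := pselect (B 0).
    by rewrite (_ : [set _ | _] = setT)//; apply/seteqP; split.
  by rewrite (_ : [set _ | _] = set0)//; apply/seteqP; split.
by apply: measurableI => //; exact: measurableC.
Qed.

Lemma borel_measurable_zero_on A f : measurable A -> borel_measurable f ->
  borel_measurable (zero_on A f).
Proof. by move=> mA bf B bB; apply: measurable_zero_on => //; exact: bf. Qed.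

Lemma simple_limit_zero_on A f (s : nat -> Omega -> V) : measurable A ->
  (forall k, vsimple (s k)) -> (forall w, ~ A w -> s ^~ w @ \oo --> f w) ->
  simple_limit (zero_on A f).
Proof.
move=> mA vs sf; exists (fun k => zero_on A (s k)) => [k|w]; last first.
  by rewrite /zero_on; case: ifPn => [_|/negP nA]; [exact: cvg_cst|
    by apply: sf => /mem_set].
split=> [|v]; last by apply: measurable_zero_on => //; exact: (vs k).2.
apply: (@sub_finite_set _ _ (0 |` range (s k))).
  by move=> _ [w _ <-]; rewrite /zero_on; case: ifP => _; [left|right; exists w].
by rewrite finite_setU; split; [exact: finite_set1|exact: (vs k).1].
Qed.

Lemma eq_probability_off_null (A E F : set Omega) :
  measurable A -> P A = 0%E -> measurable E -> measurable F ->
  E `&` ~` A = F `&` ~` A -> P E = P F.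
Proof.
move=> mA PA0 mE mF EF.
suff off G : measurable G -> P G = P (G `&` ~` A) by rewrite (off E)// (off F)// EF.
move=> mG; rewrite -[in LHS](setIT G) -(setUCr A) setIUr measureU//.
- rewrite [X in (X + _)%E](_ : _ = 0%E) ?add0e//.
  by apply: (subset_measure0 (B := A)) => //; exact: measurableI.
- exact: measurableI.
- by apply: measurableI => //; exact: measurableC.
- by rewrite setIACA setICr setI0.
Qed.

(** The probabilities on both sides do not change, as the two families agree off
    a null set. Thus the vectors may be assumed to behave well at every point. *)
Lemma independent_zero_on (A : set Omega) (xi : nat -> Omega -> V) :
  measurable A -> P A = 0%E -> (forall i, borel_measurable (xi i)) ->
  independent_vectors P xi -> independent_vectors P (fun i => zero_on A (xi i)).
Proof.
move=> mA PA0 bxi indep J B uJ bB.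
have offA i (C : set V) : zero_on A (xi i) @^-1` C `&` ~` A = xi i @^-1` C `&` ~` A.
  apply/seteqP; split=> w [Cw nA]; split=> //; move: Cw; rewrite /= /zero_on.
    by rewrite (memNset nA).
  by rewrite (memNset nA).
have mE (D : nat -> Omega -> V) : (forall i, borel_measurable (D i)) ->
    measurable (\bigcap_(j in [set` J]) D j @^-1` B j).
  move=> bD; rewrite bigcap_seq big_seq; apply: bigsetI_measurable => i iJ.
  by apply: bD; exact: bB.
have bmask i := borel_measurable_zero_on mA (bxi i).
transitivity (P (\bigcap_(j in [set` J]) xi j @^-1` B j)).
  apply: (eq_probability_off_null mA) => //; [exact: mE|exact: mE|].
  apply/seteqP; split=> w [Dw nA]; split=> // j Jj.
    have : (zero_on A (xi j) @^-1` B j `&` ~` A) w by split=> //; exact: Dw.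
    by rewrite offA => -[].
  have : (xi j @^-1` B j `&` ~` A) w by split=> //; exact: Dw.
  by rewrite -offA => -[].
rewrite indep//; apply: eq_big_seq => j jJ.
apply: (eq_probability_off_null mA PA0 _ _ (esym (offA j (B j)))).
  by apply: bxi; exact: bB.
by apply: bmask; exact: bB.
Qed.

End NullSets.

(** * Centered random sets are almost surely singletons *)

Section RadstromFacts.
Context {R : realType} {X : normedModType R}.
Local Notation S := (set_type (@dual_sphere R X)).
Implicit Types (A : bcset X) (z : ZX X) (g : S).

Lemma dual_sphere_norm g : `|(set_val g : cdual X)| = 1.
Proof. exact: set_valP g. Qed.

Lemma dual_sphere_le g (x : X) : ((set_val g : cdual X) x : R) <= `|x|.
Proof.
apply: (le_trans (ler_norm _)); apply: (le_trans (cdual_le _ _)).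
by rewrite dual_sphere_norm mul1r.
Qed.

Lemma ZX_le z g : `|z g| <= `|z|.
Proof. by apply: (@supnorm_ge R S R^o) => //; exact: bcfun_bounded. Qed.

Lemma ZX_norm_le z (M : R) : 0 <= M -> (forall g, `|z g| <= M) -> `|z| <= M.
Proof. by move=> M0 zM; apply: supnorm_le. Qed.

Lemma evaluation g : exists phi : cdual (ZX X), forall z, phi z = z g.
Proof.
have [//|z|phi _ phiE] := @cdual_of_dominated _ _ (fun z : ZX X => z g : R).
  by rewrite (le_trans (ler_norm _)) ?ZX_le.
by exists phi.
Qed.

Lemma dual_sphereN g : dual_sphere (- (set_val g : cdual X)).
Proof. by rewrite /dual_sphere /= normrN dual_sphere_norm. Qed.

Definition opp_sphere g : S := SigSub (mem_set (dual_sphereN g)).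

Lemma opp_sphereE g (x : X) :
  (set_val (opp_sphere g) : cdual X) x = - (set_val g : cdual X) x.
Proof. by []. Qed.

Lemma set_norm_ub A (x : X) : (A : set X) x -> `|x| <= set_norm A.
Proof. by move=> Ax; apply: (@supnorm_ge R X X A id) => //; exact: bcset_bounded. Qed.

Lemma support_fun_ge A g (x : X) : (A : set X) x ->
  (set_val g : cdual X) x <= radstrom A g.
Proof.
move=> Ax; apply: ub_le_sup; last by exists x.
exists (set_norm A) => _ [y Ay <-].
by rewrite (le_trans (dual_sphere_le _ _)) ?set_norm_ub.
Qed.

Lemma support_fun_le A g (M : R) :
  (forall x, (A : set X) x -> (set_val g : cdual X) x <= M) -> radstrom A g <= M.
Proof.
move=> AM; have [a Aa] := bcset_nonempty A; apply: ge_sup.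
  by exists ((set_val g : cdual X) a), a.
by move=> _ [x Ax <-]; exact: AM.
Qed.

(** That |R(A)| is not smaller than the norm of A takes functionals of norm 1
    norming the points of A. *)
Lemma radstrom_norm A : `|radstrom A| = set_norm A.
Proof.
apply/eqP; rewrite eq_le; apply/andP; split.
  apply: ZX_norm_le => [|g]; first exact: supnorm_ge0.
  have [a Aa] := bcset_nonempty A.
  rewrite ler_norml; apply/andP; split.
    apply: (le_trans _ (support_fun_ge g Aa)); rewrite lerNl -opp_sphereE.
    by rewrite (le_trans (dual_sphere_le _ _)) ?set_norm_ub.
  apply: support_fun_le => x Ax.
  by rewrite (le_trans (dual_sphere_le _ _)) ?set_norm_ub.
apply: supnorm_le => // x Ax /=.
have [->|x0] := eqVneq x 0; first by rewrite normr0.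
have [f f1 fx] := norming_functional1 x0.
pose g : S := SigSub (mem_set (f1 : dual_sphere f)).
have gx : (set_val g : cdual X) x = `|x| by exact: fx.
rewrite -gx; apply: (le_trans (support_fun_ge g Ax)).
by rewrite (le_trans (ler_norm _)) ?ZX_le.
Qed.

(** If b <> a both belong to A, a functional norming b - a sees a positive
    width. *)
Lemma bcset_single A :
  (forall g, radstrom A g + radstrom A (opp_sphere g) = 0) ->
  exists x, (A : set X) = [set x].
Proof.
move=> width0; have [a Aa] := bcset_nonempty A; exists a.
apply/seteqP; split=> [b Ab|_ ->//]; apply/eqP/negPn/negP => ba /=.
have ba0 : b - a != 0 by rewrite subr_eq0.
have [f f1 fx] := norming_functional1 ba0.
pose g : S := SigSub (mem_set (f1 : dual_sphere f)).
have := lerD (support_fun_ge g Ab) (support_fun_ge (opp_sphere g) Aa).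
rewrite width0 opp_sphereE -linearB [X in X <= _](_ : _ = `|b - a|); last exact: fx.
by rewrite normr_le0 (negbTE ba0).
Qed.

Lemma radstrom_single A (x : X) g : (A : set X) = [set x] ->
  radstrom A g = (set_val g : cdual X) x.
Proof.
by move=> Ax; rewrite /= /support_fun Ax image_set1 sup1.
Qed.

Lemma radstrom0 : radstrom (bcset0 : bcset X) = 0.
Proof.
apply/val_inj/funext => g /=; rewrite /support_fun image_set1 sup1.
exact: linear0.
Qed.

(** On singletons the embedding is evaluation at a point, thus linear and, by
    Hahn-Banach, isometric. *)
Lemma norm_sum_radstrom_single (A : nat -> bcset X) (x : nat -> X) n (a : nat -> R) :
  (forall i, (A i : set X) = [set x i]) ->
  `|\sum_(i < n) a i *: radstrom (A i)| = `|\sum_(i < n) a i *: x i|.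
Proof.
move=> Ax; set y := \sum_(i < n) a i *: x i.
have zE g : (\sum_(i < n) a i *: radstrom (A i)) g = (set_val g : cdual X) y.
  have [phi phiE] := evaluation g.
  rewrite -phiE !linear_sum; apply: eq_bigr => i _.
  by rewrite !linearZ /= phiE (radstrom_single _ (Ax i)).
apply/eqP; rewrite eq_le; apply/andP; split.
  apply: ZX_norm_le => // g; rewrite zE (le_trans (cdual_le _ _))//.
  by rewrite dual_sphere_norm mul1r.
have [->|y0] := eqVneq y 0; first by rewrite normr0.
have [f f1 fy] := norming_functional1 y0.
pose g : S := SigSub (mem_set (f1 : dual_sphere f)).
have gy : (set_val g : cdual X) y = `|y| by exact: fy.
by rewrite -gy -zE (le_trans (ler_norm _)) ?ZX_le.
Qed.

Lemma big_set_add_single (x : nat -> X) n :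
  \big[set_add/[set (0 : X)]]_(i < n) [set x i] = [set \sum_(i < n) x i].
Proof.
elim/big_rec2: _ => // i y1 y2 _ ->; apply/seteqP; split=> [_ [_ -> [_ -> <-]]//|_ ->].
by exists (x i) => //; exists y1.
Qed.

Lemma set_norm_scale_single (t : R) (x : X) :
  set_norm (set_scale t [set x]) = `|t| * `|x|.
Proof.
rewrite /set_norm /set_scale image_set1 /supnorm image_set1 sup1.
by rewrite normrZ.
Qed.

End RadstromFacts.

Section CenteredRandomSets.
Context {R : realType} {X : normedModType R} {d : measure_display}
  {Omega : measurableType d} (P : probability Omega R).

Lemma random_set_sqr_norm (F : Omega -> bcset X) : random_set F ->
  measurable_fun setT (fun w => (`|radstrom (F w)| ^+ 2)%:E).
Proof.
move=> rF; apply/measurable_EFinP; apply: measurable_funX.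
by apply: borel_measurable_norm; exact: borel_measurable_open.
Qed.

Lemma integrable_cdual_radstrom (F : Omega -> bcset X) (phi : cdual (ZX X)) :
  random_set F -> (\int[P]_w ((set_norm (F w)) ^+ 2)%:E < +oo)%E ->
  P.-integrable setT (fun w => (phi (radstrom (F w)) : R)%:E).
Proof.
move=> rF F2; have bF := borel_measurable_open rF.
apply: (@le_integrable _ _ _ _ _ measurableT _
    (fun w => `|phi|%:E * (1%:E + (`|radstrom (F w)| ^+ 2)%:E))%E).
- by apply/measurable_EFinP; apply: (borel_measurable_comp bF); exact: cdual_continuous.
- move=> w _; rewrite -EFinD -EFinM !abse_EFin lee_fin.
  rewrite (le_trans (cdual_le _ _))// (le_trans _ (ler_norm _))// ler_wpM2l//.
  by have := sqr_ge0 (`|radstrom (F w)| - 1); nra.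
- apply: integrableZl => //; apply: integrableD => //.
    exact: finite_measure_integrable_cst.
  apply/integrableP; split; first exact: random_set_sqr_norm.
  under eq_integral do rewrite gee0_abs ?lee_fin ?sqr_ge0// radstrom_norm.
  exact: F2.
Qed.

Lemma centered_cdual (F : Omega -> bcset X) (phi : cdual (ZX X)) :
  random_set F -> (\int[P]_w ((set_norm (F w)) ^+ 2)%:E < +oo)%E ->
  expectation_is P F bcset0 -> (\int[P]_w (phi (radstrom (F w)) : R)%:E = 0)%E.
Proof.
move=> rF F2 [_ EF].
have := bochner_integral_cdual (borel_measurable_open rF)
  (integrable_cdual_radstrom phi rF F2) EF.
by rewrite radstrom0 linear0.
Qed.

(** Each width R(F)(g) + R(F)(-g) is nonnegative with zero integral, hence
    almost surely 0, and then so for all g at once. *)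
Lemma centered_random_set_ae_single (F : Omega -> bcset X) :
  random_set F -> (\int[P]_w ((set_norm (F w)) ^+ 2)%:E < +oo)%E ->
  expectation_is P F bcset0 ->
  {ae P, forall w, exists x, (F w : set X) = [set x]}.
Proof.
move=> rF F2 EF.
pose q (g : set_type (@dual_sphere R X)) (z : ZX X) : R := z g + z (opp_sphere g).
suff : {ae P, forall w, forall g, q g (radstrom (F w)) = 0}.
  by apply: filterS => w qw; apply: bcset_single => g; exact: qw.
apply: (ae_forall_equilipschitz (f := radstrom \o F)) => [g u v||g].
- have [phi phiE] := evaluation g; have [psi psiE] := evaluation (opp_sphere g).
  have h1 : `|u g - v g| <= `|u - v|.
    have -> : u g - v g = phi (u - v) by rewrite linearB /= !phiE.
    by rewrite phiE ZX_le.
  have h2 : `|u (opp_sphere g) - v (opp_sphere g)| <= `|u - v|.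
    have -> : u (opp_sphere g) - v (opp_sphere g) = psi (u - v).
      by rewrite linearB /= !psiE.
    by rewrite psiE ZX_le.
  have := ler_normD (u g - v g) (u (opp_sphere g) - v (opp_sphere g)).
  by rewrite /q opprD addrACA; lra.
- exact: EF.1.1.
have [phi phiE] := evaluation g; have [psi psiE] := evaluation (opp_sphere g).
have qE w : (q g (radstrom (F w)))%:E =
    ((phi (radstrom (F w)) : R)%:E + (psi (radstrom (F w)) : R)%:E)%E.
  by rewrite phiE psiE.
have q_ge0 w : 0 <= q g (radstrom (F w)).
  have [a Fa] := bcset_nonempty (F w).
  have := lerD (support_fun_ge g Fa) (support_fun_ge (opp_sphere g) Fa).
  by rewrite opp_sphereE subrr.
have iphi := integrable_cdual_radstrom phi rF F2.
have ipsi := integrable_cdual_radstrom psi rF F2.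
have mq : measurable_fun setT (fun w => (q g (radstrom (F w)))%:E).
  under eq_fun do rewrite qE.
  by apply: emeasurable_funD; [exact: measurable_int iphi|exact: measurable_int ipsi].
have q0 : (\int[P]_w `|(q g (radstrom (F w)))%:E| = 0)%E.
  under eq_integral do rewrite gee0_abs ?lee_fin// qE.
  by rewrite integralD// !centered_cdual// adde0.
have := (ae_eq_integral_abs P measurableT mq).1 q0.
by apply: filterS => w /(_ Logic.I) [].
Qed.

End CenteredRandomSets.

(** * The strong law for random sets *)

Theorem theorem5p6 (R : realType) (X : completeNormedModType R)
    (d : measure_display) (Omega : measurableType d) (P : probability Omega R)
    (Psi : nat -> Omega -> bcset X) :
  b_convex X ->
  (forall n, random_set (Psi n)) ->
  independent_sets P Psi ->
  (forall n, expectation_is P (Psi n) bcset0) ->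
  (ereal_sup (range (fun n => \int[P]_w ((set_norm (Psi n w)) ^+ 2)%:E))
    < +oo)%E ->
  {ae P, forall w,
    set_norm (set_scale n.+1%:R^-1
      (\big[set_add/[set (0 : X)]]_(i < n.+1) (Psi i w : set X)))
    @[n --> \oo] --> (0 : R)}.
Proof.
move=> BX rPsi indep EPsi supPsi.
set E2 := ereal_sup _ in supPsi.
have Psi2_ge0 n : (0 <= \int[P]_w ((set_norm (Psi n w)) ^+ 2)%:E)%E.
  by apply: integral_ge0 => w _; rewrite lee_fin sqr_ge0.
have Psi2_le n : (\int[P]_w ((set_norm (Psi n w)) ^+ 2)%:E <= E2)%E.
  by apply: ereal_sup_ubound; exists n.
have Psi2 n := le_lt_trans (Psi2_le n) supPsi.
have [M ME] : exists M : R, E2 = M%:E.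
  eexists; apply/esym/fineK; rewrite ge0_fin_numE//.
  exact: le_trans (Psi2_ge0 0%N) (Psi2_le 0%N).
pose psi n := radstrom \o Psi n.
have bpsi n : borel_measurable (psi n) by exact: borel_measurable_open (rPsi n).
have /choice[s sP] n : exists s : nat -> Omega -> ZX X,
    (forall k, vsimple (s k)) /\ {ae P, forall w, s ^~ w @ \oo --> psi n w}.
  by have [s vs sf] := (EPsi n).1.1; exists s.
have : {ae P, forall w, forall n, s n ^~ w @ \oo --> psi n w /\
    exists x, (Psi n w : set X) = [set x]}.
  apply: ae_foralln => n; apply: filterS2 (sP n).2 _; last first.
    exact: centered_random_set_ae_single (rPsi n) (Psi2 n) (EPsi n).
  by [].
move=> [N [mN PN0 Ngood]].
have good w : ~ N w -> forall n, s n ^~ w @ \oo --> psi n w /\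
    exists x, (Psi n w : set X) = [set x].
  by move=> nN; apply: contrapT => bad; apply: nN; exact: Ngood.
(* redefined as 0 on N, the vectors have the required properties everywhere *)
pose xi n := zero_on N (psi n).
have xi_le n w : `|xi n w| <= set_norm (Psi n w).
  rewrite -radstrom_norm /xi /zero_on; case: ifP => // _; rewrite normr0.
  exact: normr_ge0.
have slxi n : simple_limit (xi n).
  by apply: (simple_limit_zero_on mN (sP n).1) => w /good/(_ n)[].
have xiM n : (\int[P]_w (`|xi n w| ^+ 2)%:E <= M%:E)%E.
  rewrite -ME; apply: le_trans (Psi2_le n); apply: ge0_le_integral => //.
  - exact: measurable_sqr_norm.
  - have := random_set_sqr_norm (rPsi n).
    by under eq_fun do rewrite radstrom_norm.
  - by move=> w _; rewrite lee_fin; apply: ler_sqr_ge0.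
have xi2 n : square_integrable P (xi n).
  split=> //; apply/integrableP; split; first exact: measurable_sqr_norm.
  under eq_integral do rewrite gee0_abs ?lee_fin ?sqr_ge0//.
  exact: le_lt_trans (xiM n) (ltry M).
have bxi n : borel_measurable (xi n) by exact: borel_measurable_zero_on.
have xi0 n (phi : cdual (ZX X)) : (\int[P]_w (phi (xi n w) : R)%:E = 0)%E.
  rewrite -(centered_cdual phi (rPsi n) (Psi2 n) (EPsi n)).
  apply: ae_eq_integral => //.
  - by apply/measurable_EFinP; apply: (borel_measurable_comp (bxi n));
      exact: cdual_continuous.
  - by apply/measurable_EFinP; apply: (borel_measurable_comp (bpsi n));
      exact: cdual_continuous.
  - exists N; split=> // w /= h; apply: contrapT => nN; apply: h => _.
    by rewrite /xi /zero_on memNset.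
have xiX w : exists x : nat -> X, forall n (a : nat -> R),
    `|\sum_(i < n) a i *: xi i w| = `|\sum_(i < n) a i *: x i|.
  have [Nw|nN] := pselect (N w).
    exists (fun=> 0) => n a; rewrite !big1 ?normr0// => i _; rewrite ?scaler0//.
    by rewrite /xi /zero_on mem_set// scaler0.
  have /choice[x xE] n := (good w nN n).2.
  exists x => n a; rewrite -(norm_sum_radstrom_single _ _ xE).
  by under eq_bigr do rewrite /xi /zero_on memNset//.
have ixi : independent_vectors P xi by exact: independent_zero_on.
have slln := b_convex_slln BX bxi ixi xi2 xi0 xiX xiM.
have offN : {ae P, forall w, ~ N w}.
  by exists N; split=> // w /= /contrapT.
apply: filterS2 slln offN => w + nN.
have /choice[x xE] n := (good w nN n).2.
apply: cvg_trans; apply: near_eq_cvg; apply: nearW => n /=.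
have normE : `|\sum_(i < n.+1) xi i w| = `|\sum_(i < n.+1) x i|.
  have := norm_sum_radstrom_single n.+1 (fun=> 1) xE.
  rewrite (eq_bigr (fun i : 'I_n.+1 => xi i w)) => [->|i _]; last first.
    by rewrite scale1r /xi /zero_on memNset.
  by congr `|_|; apply: eq_bigr => i _; rewrite scale1r.
rewrite normE (eq_bigr (fun i : 'I_n.+1 => [set x i])) => [|i _]; last exact: xE.
by rewrite big_set_add_single set_norm_scale_single ger0_norm.
Qed.
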